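(* Let $\Sigma$ be a vertical $R$-soliton in $\mathbb{S}^2\times\mathbb{R}$, where $R=-y\partial_x+x\partial_y$. Then $\Sigma$ is the cylinder $\mathcal{C}=(\mathbb{S}^1\times\{0\})\times\mathbb{R}$, or $\Sigma$ is parametrized by $$\Psi(s,t)=(\cos u(s)\cos v(s),\cos u(s)\sin v(s),\sin u(s),t)$$ with the following properties: (1) The curve $\beta(s)=(u(s),v(s))$ has self-intersections and it is asymptotic to the $v$-axis at infinity. In case that $\beta$ satisfies the initial conditions $u(0)=v(0)=\theta(0)=0$, then $\beta$ is a symmetric bi-graph on the $v$-axis. (2) The surface $\Sigma$ is not embedded with infinitely many intersection points with the $z$-axis. (3) The surface $\Sigma$ is asymptotic to the cylinder $\mathcal{C}$.
   Context: $\mathbb{S}^2$ is the unit sphere of $\mathbb{R}^3$, and $\mathbb{S}^2\times\mathbb{R}\subset\mathbb{R}^4$ carries the product metric with coordinates $(x,y,z,t)$, $x^2+y^2+z^2=1$. $R=-y\partial_x+x\partial_y$ is the Killing field of rotations about the $z$-axis (the axis of the coordinate $z$) of $\mathbb{S}^2$. The mean curvature $H$ of a surface is the sum of its principal curvatures with respect to a unit normal $N$; a surface is an $R$-soliton if $H=\langle N,R\rangle$ on it. A vertical surface is one invariant under all vertical translations $T_\lambda(p,t)=(p,t+\lambda)$, $\lambda\in\mathbb{R}$. It is parametrized by $\Psi(s,t)=(\cos u(s)\cos v(s),\cos u(s)\sin v(s),\sin u(s),t)$, $s\in I\subset\mathbb{R}$, $t\in\mathbb{R}$, with $u,v$ smooth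 and $\cos u(s)\neq0$ by regularity; its generating curve is $\alpha(s)=(\cos u(s)\cos v(s),\cos u(s)\sin v(s),\sin u(s))\in\mathbb{S}^2$. The curve $\beta=(u,v)$ is parametrized so that $u'=\cos u\cos\theta$, $v'=\sin\theta$ for a smooth function $\theta=\theta(s)$. With this parametrization, $\Sigma$ is an $R$-soliton if and only if $\theta'=\sin\theta\sin u+(\cos u)^2\cos\theta$. The cylinder is $\mathcal{C}=\{(x,y,0,t):x^2+y^2=1,\ t\in\mathbb{R}\}$, corresponding to $u\equiv0$, $v(s)=\pm s$. The $v$-axis is the line $\{u=0\}$ in the $(u,v)$-plane. ''Asymptotic to the $v$-axis at infinity'' means $u(s)\to0$ and $v(s)\to+\infty$ as $s\to\pm\infty$. ''Symmetric bi-graph on the $v$-axis'' means that $\beta$ is symmetric about the $v$-axis and each of the two branches $\beta((0,\infty))$ and $\beta((-\infty,0))$ is a graph on the $v$-axis. ''$\Sigma$ is asymptotic to $\mathcal{C}$'' means that the distance from $\alpha(s)$ to the geodesic $\{z=0\}$ of $\mathbb{S}^2$ tends to $0$ as $s\to\pm\infty$.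
   Formalization: Σ is assumed complete with s ranging over ℝ (otherwise curves running into a pole are counterexamples), u is normalized to (−π/2, π/2), and ''intersection points with the z-axis'', impossible since cos u ≠ 0, is read as points of β on the v-axis. *)

(* Defs.v *)
From Stdlib Require Import Reals List.
From Coquelicot Require Import Coquelicot.
Open Scope R_scope.

Definition smooth (f : R -> R) : Prop := forall n x, ex_derive_n f n x.

(** * Parametrized surfaces of S^2 x R, seen inside R^4 *)

Definition R4 : Type := (R * R * R * R)%type.

Definition cx (p : R4) : R := let '(x, _, _, _) := p in x.
Definition cy (p : R4) : R := let '(_, y, _, _) := p in y.
Definition cz (p : R4) : R := let '(_, _, z, _) := p in z.
Definition ct (p : R4) : R := let '(_, _, _, t) := p in t.

Definition dot (p q : R4) : R :=
  cx p * cx q + cy p * cy q + cz p * cz q + ct p * ct q.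

Definition deriv4 (c : R -> R4) (s : R) : R4 :=
  (Derive (fun r => cx (c r)) s, Derive (fun r => cy (c r)) s,
   Derive (fun r => cz (c r)) s, Derive (fun r => ct (c r)) s).

Definition surface : Type := R -> R -> R4.

Definition d_s (X : surface) : surface := fun s t => deriv4 (fun r => X r t) s.
Definition d_t (X : surface) : surface := fun s t => deriv4 (fun r => X s r) t.

Definition image (X : surface) (p : R4) : Prop := exists s t, p = X s t.

Definition form_E (X : surface) s t := dot (d_s X s t) (d_s X s t).
Definition form_F (X : surface) s t := dot (d_s X s t) (d_t X s t).
Definition form_G (X : surface) s t := dot (d_t X s t) (d_t X s t).

(** [(x, y, z, 0)] is the normal of S^2 x R in R^4 at [(x, y, z, t)], so the
    second clause says that [n] is tangent to S^2 x R. *)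
Definition unit_normal (X : surface) (s t : R) (n : R4) : Prop :=
  dot n n = 1 /\
  dot n (cx (X s t), cy (X s t), cz (X s t), 0) = 0 /\
  dot n (d_s X s t) = 0 /\
  dot n (d_t X s t) = 0.

(** As [n] is tangent to S^2 x R, pairing the second derivatives of [X] in R^4
    with [n] gives the second fundamental form of the surface in S^2 x R. *)
Definition form_e (X : surface) s t n := dot (d_s (d_s X) s t) n.
Definition form_f (X : surface) s t n := dot (d_t (d_s X) s t) n.
Definition form_g (X : surface) s t n := dot (d_t (d_t X) s t) n.

(** The eigenvalues, with multiplicity, of the shape operator I^-1 II:
    det (II - k I) = det I * (k - k1) * (k - k2). *)
Definition principal_curvatures (X : surface) (s t : R) (n : R4) (k1 k2 : R)
  : Prop :=
  forall k : R,
    (form_e X s t n - k * form_E X s t) * (form_g X s t n - k * form_G X s t)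
      - (form_f X s t n - k * form_F X s t) ^ 2
    = (form_E X s t * form_G X s t - form_F X s t ^ 2) * ((k - k1) * (k - k2)).

Definition is_mean_curvature (X : surface) (s t : R) (n : R4) (H : R) : Prop :=
  exists k1 k2, principal_curvatures X s t n k1 k2 /\ H = k1 + k2.

(** The rotation field -y d_x + x d_y. *)
Definition rotation (p : R4) : R4 := (- cy p, cx p, 0, 0).

(** Both sides of H = <N, R> change sign with N, so asking it for both unit
    normals is the same as asking it for one of them. *)
Definition R_soliton (X : surface) : Prop :=
  forall s t n, unit_normal X s t n ->
    is_mean_curvature X s t n (dot n (rotation (X s t))).

(** Completeness of the induced metric on the parameter plane: every smooth
    path that eventually leaves each compact set has infinite length. *)
Definition divergent_path (g h : R -> R) : Prop :=
  forall M, exists T, forall r, T <= r -> M < Rabs (g r) \/ M < Rabs (h r).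

Definition path_speed (X : surface) (g h : R -> R) (r : R) : R :=
  sqrt (form_E X (g r) (h r) * Derive g r ^ 2
        + 2 * form_F X (g r) (h r) * (Derive g r * Derive h r)
        + form_G X (g r) (h r) * Derive h r ^ 2).

Definition complete_surface (X : surface) : Prop :=
  forall g h, smooth g -> smooth h -> divergent_path g h ->
    is_lim (fun T => RInt (path_speed X g h) 0 T) p_infty p_infty.

(** Two parameters with the same image must parametrize the same sheet, so
    that [X] is injective up to reparametrization.  Plain injectivity would
    exclude closed generating curves, such as that of the cylinder. *)
Definition embedded (X : surface) : Prop :=
  forall s1 t1 s2 t2, X s1 t1 = X s2 t2 ->
    forall U : R * R -> Prop, locally (s1, t1) U ->
      locally (s2, t2)
        (fun q => exists p, U p /\ X (fst p) (snd p) = X (fst q) (snd q)).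

(** * Vertical surfaces *)

Definition Psi (u v : R -> R) : surface := fun s t =>
  (cos (u s) * cos (v s), cos (u s) * sin (v s), sin (u s), t).

(** Regularity requires cos u <> 0.  Replacing (u, v) by (PI - u, v + PI) or
    (u - 2 PI, v) changes neither the surface nor the two differential
    equations, so the latitude [u] is normalized to lie in (-PI/2, PI/2). *)
Record vertical_parametrization (u v theta : R -> R) : Prop := {
  vp_smooth_u : smooth u;
  vp_smooth_v : smooth v;
  vp_smooth_theta : smooth theta;
  vp_latitude : forall s, - (PI / 2) < u s < PI / 2;
  vp_u' : forall s, is_derive u s (cos (u s) * cos (theta s));
  vp_v' : forall s, is_derive v s (sin (theta s))
}.

Definition cylinder (p : R4) : Prop := cx p ^ 2 + cy p ^ 2 = 1 /\ cz p = 0.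

(** * The curve beta = (u, v) in the plane *)

Definition self_intersecting (u v : R -> R) : Prop :=
  exists s1 s2, s1 <> s2 /\ u s1 = u s2 /\ v s1 = v s2.

Definition asymptotic_to_v_axis (u v : R -> R) : Prop :=
  (is_lim u p_infty 0 /\ is_lim v p_infty p_infty) /\
  (is_lim u m_infty 0 /\ is_lim v m_infty p_infty).

Definition curve_image (u v : R -> R) (I : R -> Prop) (p : R * R) : Prop :=
  exists s, I s /\ p = (u s, v s).

Definition graph_on_v_axis (A : R * R -> Prop) : Prop :=
  exists (J : R -> Prop) (f : R -> R),
    forall a b, A (a, b) <-> J b /\ a = f b.

Definition symmetric_about_v_axis (A : R * R -> Prop) : Prop :=
  forall a b, A (a, b) <-> A (- a, b).

Definition symmetric_bigraph (u v : R -> R) : Prop :=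
  symmetric_about_v_axis (curve_image u v (fun _ => True)) /\
  graph_on_v_axis (curve_image u v (fun s => 0 < s)) /\
  graph_on_v_axis (curve_image u v (fun s => s < 0)).

Definition meets_v_axis_infinitely_often (u v : R -> R) : Prop :=
  forall l : list (R * R), exists s, u s = 0 /\ ~ In (u s, v s) l.

(** * Distance to the geodesic {z = 0} of S^2 *)

Definition R3 : Type := (R * R * R)%type.

Definition alpha (u v : R -> R) (s : R) : R3 :=
  (cos (u s) * cos (v s), cos (u s) * sin (v s), sin (u s)).

Definition sphere_dist (p q : R3) : R :=
  let '(x, y, z) := p in
  let '(x', y', z') := q in
  acos (x * x' + y * y' + z * z').

Definition equator (p : R3) : Prop :=
  let '(x, y, z) := p in x ^ 2 + y ^ 2 = 1 /\ z = 0.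

Definition dist_to_equator (p : R3) : R :=
  real (Glb_Rbar (fun d => exists q, equator q /\ d = sphere_dist p q)).

Definition asymptotic_to_cylinder (u v : R -> R) : Prop :=
  is_lim (fun s => dist_to_equator (alpha u v s)) p_infty 0 /\
  is_lim (fun s => dist_to_equator (alpha u v s)) m_infty 0.

(* Main.v *)
Require Import Defs.
From Stdlib Require Import Reals List Lra Psatz Classical IndefiniteDescription.
From Coquelicot Require Import Coquelicot.
Open Scope R_scope.

(** The soliton condition on [Psi u v] is a differential system for
    (u, v, theta) ([soliton_profile_of_R_soliton]).  Its key quantity is the
    Clairaut function L = cos u sin theta, for which L' = cos u (cos u cos theta)^2,
    so that L is nondecreasing, with values in [-1, 1].  If |L| = 1 somewhere, the
    curve is tangent to the equator and by uniqueness it is the equator: the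
    surface is the cylinder ([cylinder_of_equilibrium]).

    Otherwise a Lyapunov argument shows that L tends to 1 at +oo
    ([clairaut_tends_to_1]).  Completeness enters only there, through the infinite
    length of both halves of the generating curve: it excludes the curves that
    reach a pole.  As the system is invariant under reversal of the curve
    ([profile_reverse]), L tends to -1 at -oo.  Since
    (sin u)^2 + (cos u cos theta)^2 + L^2 = 1, the latitude tends to 0 at both
    ends, which gives the asymptotics to the cylinder; and v' = sin theta has the
    sign of L, so v tends to +oo at both ends.

    Near infinity the two ends are therefore graphs of u over the longitude.  In
    the coordinate y = tan u both satisfy one autonomous equation
    y'' = - y - damping y y', and so does the equator y = 0.  Its linearization
    y'' + y' + y = 0 at the origin is under-damped, so the difference of any two of
    these small solutions keeps vanishing ([graph_ends_cross]).  Applied to an end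
    and the equator, this gives infinitely many points on the axis; applied to the
    two ends, it gives self-intersections.  A self-intersection is never
    tangential, for otherwise uniqueness would make the curve invariant under
    a reversal of its parameter, which is impossible at the fixed parameter
    ([no_tangential_crossing]).  So the sheets through it differ and the
    surface is not embedded.

    When u, v and theta vanish at 0, uniqueness makes u odd and v even, and L is
    positive on (0, +oo), so v is monotone on each half. *)

(** * Calculus on the line *)

Lemma is_derive_continuity_pt (f : R -> R) (x l : R) :
  is_derive f x l -> continuity_pt f x.
Proof.
  intros H. apply derivable_continuous_pt. exists l. now apply is_derive_Reals.
Qed.

Lemma mean_value (f f' : R -> R) (a b : R) :
  a < b -> (forall x, a <= x <= b -> is_derive f x (f' x)) ->
  exists c, a < c < b /\ f b - f a = f' c * (b - a).
Proof.
  intros Hab Hf.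
  destruct (MVT_cor2 f f' a b Hab) as [c [Hc1 Hc2]].
  - intros c Hc. now apply is_derive_Reals, Hf.
  - exists c. now split.
Qed.

Lemma derive_nonneg_le (f f' : R -> R) (a b : R) :
  a <= b -> (forall x, a <= x <= b -> is_derive f x (f' x)) ->
  (forall x, a <= x <= b -> 0 <= f' x) -> f a <= f b.
Proof.
  intros [Hab | <-] Hf Hp; [| lra].
  destruct (mean_value f f' a b Hab Hf) as [c [Hc E]].
  assert (0 <= f' c * (b - a)) by (apply Rmult_le_pos; [apply Hp |]; lra).
  lra.
Qed.

Lemma derive_nonpos_ge (f f' : R -> R) (a b : R) :
  a <= b -> (forall x, a <= x <= b -> is_derive f x (f' x)) ->
  (forall x, a <= x <= b -> f' x <= 0) -> f b <= f a.
Proof.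
  intros Hab Hf Hp.
  enough (- f a <= - f b) by lra.
  apply (derive_nonneg_le (fun x => - f x) (fun x => - f' x)); [exact Hab | |].
  - intros x Hx. apply (is_derive_opp f), Hf, Hx.
  - intros x Hx. specialize (Hp x Hx). lra.
Qed.

Lemma derive_pos_lt (f f' : R -> R) (a b : R) :
  a < b -> (forall x, a <= x <= b -> is_derive f x (f' x)) ->
  (forall x, a < x <= b -> 0 < f' x) -> f a < f b.
Proof.
  intros Hab Hf Hp.
  destruct (mean_value f f' a b Hab Hf) as [c [Hc E]].
  assert (0 < f' c * (b - a)) by (apply Rmult_lt_0_compat; [apply Hp |]; lra).
  lra.
Qed.

Lemma is_lim_p_infty_spec (f : R -> R) :
  is_lim f p_infty p_infty -> forall M, exists T, forall x, T < x -> M < f x.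
Proof. intros H M. apply is_lim_spec in H. exact (H M). Qed.

(** The end of a generating curve on which the longitude increases to infinity
    is parametrized by its longitude through this inverse function. *)
Lemma increasing_inverse (f f' : R -> R) (a : R) :
  (forall s, is_derive f s (f' s)) ->
  (forall s, a < s -> 0 < f' s) ->
  is_lim f p_infty p_infty ->
  exists g, forall x, f a < x ->
    a < g x /\ f (g x) = x /\ is_derive g x (/ f' (g x)).
Proof.
  intros Hf Hpos Hlim.
  assert (Hinc : forall s t, a <= s -> s < t -> f s < f t).
  { intros s t Hs Hst. apply (derive_pos_lt f f'); auto.
    intros x Hx. apply Hpos. lra. }
  destruct (functional_choice (fun x s : R => f a < x -> a < s /\ f s = x))
    as [g Hg].
  { intros x. destruct (Rlt_dec (f a) x) as [Hx | Hx]; [| now exists 0].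
    destruct (is_lim_p_infty_spec f Hlim x) as [T HT].
    pose (b := Rmax (T + 1) (a + 1)).
    assert (Hb : a < b) by (unfold b; pose proof (Rmax_r (T + 1) (a + 1)); lra).
    assert (HTb : T < b) by (unfold b; pose proof (Rmax_l (T + 1) (a + 1)); lra).
    destruct (IVT_gen f a b x) as [s [Hs E]].
    - intros s. exact (is_derive_continuity_pt _ _ _ (Hf s)).
    - specialize (HT b HTb). rewrite Rmin_left, Rmax_right; lra.
    - rewrite Rmin_left, Rmax_right in Hs by lra.
      exists s. intros _. split; [| exact E].
      destruct (proj1 Hs) as [H | <-]; [exact H | lra]. }
  exists g. intros x Hx. destruct (Hg x Hx) as [Hgx E].
  split; [exact Hgx |]. split; [exact E |].
  set (s := g x) in *.
  pose proof (Hpos s Hgx) as Hd. set (d := f' s) in *.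
  assert (Hcont : forall e, 0 < e -> exists del, 0 < del /\ x - del > f a /\
    forall y, Rabs (y - x) < del -> Rabs (g y - s) < e).
  { intros e He.
    pose (e' := Rmin e ((s - a) / 2)).
    assert (He' : 0 < e') by (unfold e'; apply Rmin_glb_lt; lra).
    assert (Ha' : e' <= (s - a) / 2) by apply Rmin_r.
    assert (Hee : e' <= e) by apply Rmin_l.
    pose proof (Hinc (s - e') s ltac:(lra) ltac:(lra)) as H1.
    pose proof (Hinc s (s + e') ltac:(lra) ltac:(lra)) as H2.
    pose proof (Hinc a (s - e') ltac:(lra) ltac:(lra)) as H3.
    exists (Rmin (x - f (s - e')) (f (s + e') - x)).
    pose proof (Rmin_l (x - f (s - e')) (f (s + e') - x)).
    pose proof (Rmin_r (x - f (s - e')) (f (s + e') - x)).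
    split; [apply Rmin_glb_lt; lra |]. split; [lra |].
    intros y Hy. apply Rabs_def2 in Hy.
    destruct (Hg y ltac:(lra)) as [Hgy Ey].
    apply Rabs_def1.
    - apply Rnot_le_lt. intros Hn.
      assert (f (s + e') <= f (g y)); [| lra].
      destruct (Req_dec (s + e') (g y)) as [-> | Hne]; [lra |].
      left. apply Hinc; lra.
    - apply Rnot_le_lt. intros Hn.
      assert (f (g y) <= f (s - e')); [| lra].
      destruct (Req_dec (s - e') (g y)) as [<- | Hne]; [lra |].
      left. apply Hinc; lra. }
  apply is_derive_Reals. intros eps Heps.
  pose (eta := Rmin (d / 2) (eps * (d * d) / 4)).
  assert (Heta : 0 < eta).
  { unfold eta. apply Rmin_glb_lt; [lra |].
    assert (0 < eps * (d * d)) by (apply Rmult_lt_0_compat; nra). lra. }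
  assert (Heta1 : eta <= d / 2) by apply Rmin_l.
  assert (Heta2 : eta <= eps * (d * d) / 4) by apply Rmin_r.
  destruct (proj1 (is_derive_Reals _ _ _) (Hf s) eta Heta) as [e He].
  destruct (Hcont e (cond_pos e)) as [del [Hdel [Hdel' Hc]]].
  exists (mkposreal del Hdel). intros h Hh0 Hh. simpl in Hh.
  pose (k := g (x + h) - s).
  assert (Hk : Rabs k < e).
  { apply Hc. replace (x + h - x) with h by ring. exact Hh. }
  assert (Efk : f (s + k) = x + h).
  { unfold k. replace (s + (g (x + h) - s)) with (g (x + h)) by ring.
    apply Hg. apply Rabs_def2 in Hh. lra. }
  assert (Hk0 : k <> 0).
  { intros Hk0. rewrite Hk0, Rplus_0_r in Efk. lra. }
  specialize (He k Hk0 Hk). rewrite Efk, E in He.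
  replace (x + h - x) with h in He by ring.
  change (g x) with s. fold k. fold d in He. apply Rabs_def2 in He.
  set (q := h / k) in *.
  assert (Hq : d / 2 <= q) by lra.
  replace (k / h - / d) with ((d - q) * / (q * d)).
  2:{ unfold q. field. repeat split; auto. lra. }
  assert (Hqd : 0 < q * d) by (apply Rmult_lt_0_compat; lra).
  rewrite Rabs_mult, (Rabs_right (/ (q * d))).
  2:{ left. now apply Rinv_0_lt_compat. }
  apply Rmult_lt_reg_r with (q * d); [exact Hqd |].
  rewrite Rmult_assoc, Rinv_l, Rmult_1_r by lra.
  assert (Rabs (d - q) < eta) by (apply Rabs_def1; lra).
  assert (d / 2 * d <= q * d) by (apply Rmult_le_compat_r; lra).
  assert (eps * (d / 2 * d) <= eps * (q * d)) by (apply Rmult_le_compat_l; lra).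
  assert (0 < eps * (d * d)) by (apply Rmult_lt_0_compat; nra).
  lra.
Qed.

(** * Oscillation *)

(** A perturbation of [D'' + D' + D = 0], which is under-damped, so its
    solutions rotate in the phase plane.  Where [D] does not vanish, the phase
    [atan (D' / D)] decreases at a rate of at least 1 - 1/2 - 3/20 = 7/20, and
    a bounded function cannot do so on a half-line. *)
Lemma damped_oscillator_has_zero (D Q E : R -> R) (V : R) :
  (forall x, V < x ->
     is_derive D x (Q x) /\ is_derive Q x (- D x - Q x + E x) /\
     Rabs (E x) <= / 10 * (Rabs (D x) + Rabs (Q x))) ->
  exists x, V < x /\ D x = 0.
Proof.
  intros H. apply NNPP. intros Hn.
  assert (Hnz : forall x, V < x -> D x <> 0) by (intros x Hx Ex; apply Hn; eauto).
  (* Over an interval of length 20 the phase would drop by 6 > PI. *)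
  pose (A := fun x => atan (Q x / D x) + 3 / 10 * x).
  assert (HA : A (V + 21) <= A (V + 1)).
  { apply (derive_nonpos_ge A (fun x =>
      ((- D x - Q x + E x) * D x - Q x * Q x) / (D x * D x + Q x * Q x) + 3 / 10));
      [lra | |].
    - intros x Hx. destruct (H x ltac:(lra)) as [HD [HQ _]].
      pose proof (Hnz x ltac:(lra)) as Hz.
      assert (0 < D x * D x) by nra.
      unfold A. auto_derive.
      + repeat split; [eexists; exact HQ | eexists; exact HD | exact Hz].
      + replace (Derive (fun x0 => D x0) x) with (Q x)
          by (symmetry; now apply is_derive_unique).
        replace (Derive (fun x0 => Q x0) x) with (- D x - Q x + E x)
          by (symmetry; now apply is_derive_unique).
        unfold Rsqr. field. split; [nra | exact Hz].
    - intros x Hx. destruct (H x ltac:(lra)) as [_ [_ HE]].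
      pose proof (Hnz x ltac:(lra)) as Hz.
      assert (0 < D x * D x) by nra.
      set (d := D x) in *. set (q := Q x) in *. set (e := E x) in *.
      assert (HED : e * d <= / 10 * (3 / 2) * (d * d + q * q)).
      { apply Rle_trans with (Rabs e * Rabs d).
        - rewrite <- Rabs_mult. apply Rle_abs.
        - assert (Rabs d * Rabs d = d * d) by (rewrite <- Rabs_mult; apply Rabs_right, Rle_ge; nra).
          assert (Rabs q * Rabs q = q * q) by (rewrite <- Rabs_mult; apply Rabs_right, Rle_ge; nra).
          pose proof (Rabs_pos d). pose proof (Rabs_pos q).
          apply Rle_trans with (/ 10 * (Rabs d + Rabs q) * Rabs d).
          + now apply Rmult_le_compat_r.
          + nra. }
      apply Rmult_le_reg_r with (d * d + q * q); [nra |].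
      rewrite Rmult_0_l, Rmult_plus_distr_r.
      unfold Rdiv at 1. rewrite Rmult_assoc, Rinv_l by nra.
      pose proof (pow2_ge_0 (d + q)). nra. }
  unfold A in HA.
  pose proof (atan_bound (Q (V + 21) / D (V + 21))).
  pose proof (atan_bound (Q (V + 1) / D (V + 1))).
  pose proof PI_4. lra.
Qed.

(** * The equations of the generating curve *)

(** A vertical R-soliton without its regularity assumptions: this is the form
    that is stable under the symmetries below. *)
Record soliton_profile (u v theta : R -> R) : Prop := {
  sp_latitude : forall s, - (PI / 2) < u s < PI / 2;
  sp_u' : forall s, is_derive u s (cos (u s) * cos (theta s));
  sp_v' : forall s, is_derive v s (sin (theta s));
  sp_theta' : forall s, is_derive theta s
    (sin (theta s) * sin (u s) + cos (u s) ^ 2 * cos (theta s))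
}.

(** Replacement of the syntactic term [Derive (fun x => f x) y]: rewriting with
    [is_derive_unique] would try to unify the derivatives of distinct unknown
    functions by unfolding them. *)
Ltac derive_value f y H :=
  replace (Derive (fun x => f x) y) with
    ltac:(match type of (H y) with is_derive _ _ ?l => exact l end)
    by (symmetry; exact (is_derive_unique _ _ _ (H y))).

Ltac profile_derivatives H :=
  match type of H with
  | soliton_profile ?u ?v ?theta =>
    repeat match goal with
    | |- ex_derive (fun x => u x) _ => eexists; apply (sp_u' _ _ _ H)
    | |- ex_derive (fun x => v x) _ => eexists; apply (sp_v' _ _ _ H)
    | |- ex_derive (fun x => theta x) _ => eexists; apply (sp_theta' _ _ _ H)
    | |- context [Derive (fun x => u x) ?y] => derive_value u y (sp_u' _ _ _ H)
    | |- context [Derive (fun x => v x) ?y] => derive_value v y (sp_v' _ _ _ H)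
    | |- context [Derive (fun x => theta x) ?y] =>
        derive_value theta y (sp_theta' _ _ _ H)
    end
  end.

Ltac profile_derive H := auto_derive; [repeat split | idtac]; profile_derivatives H.

Lemma profile_cos_pos u v theta :
  soliton_profile u v theta -> forall s, 0 < cos (u s).
Proof. intros H s. destruct (sp_latitude _ _ _ H s). now apply cos_gt_0. Qed.

(** Reversing the curve turns the velocity by a half-turn [k] and the normal
    with it; both sides of H = <N, R> change sign, so the reversed curve again
    satisfies the equations.  Thus the past of a curve is the future of
    another one, and only forward limits need be studied. *)
Lemma profile_reverse u v theta (c k : R) :
  soliton_profile u v theta -> sin k = 0 -> cos k = -1 ->
  soliton_profile (fun s => u (c - s)) (fun s => v (c - s))
    (fun s => theta (c - s) + k).
Proof.
  intros H Hs Hc. split; intros s; rewrite ?sin_plus, ?cos_plus, ?Hs, ?Hc.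
  - apply (sp_latitude _ _ _ H).
  - profile_derive H. unfold Rminus. ring.
  - profile_derive H. unfold Rminus. ring.
  - profile_derive H. unfold Rminus. ring.
Qed.

(** The symmetry of the sphere about its equator commutes with the rotations; in
    the angle [theta] it reads as a sign change once the curve is run backwards. *)
Lemma profile_reflect u v theta :
  soliton_profile u v theta ->
  soliton_profile (fun s => - u (- s)) (fun s => v (- s)) (fun s => - theta (- s)).
Proof.
  intros H. split; intros s; rewrite ?sin_neg, ?cos_neg.
  - pose proof (sp_latitude _ _ _ H (- s)). lra.
  - profile_derive H. ring.
  - profile_derive H. ring.
  - profile_derive H. ring.
Qed.

Lemma profile_equator (v0 th0 s0 : R) :
  cos th0 = 0 ->
  soliton_profile (fun _ => 0) (fun s => v0 + sin th0 * (s - s0)) (fun _ => th0).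
Proof.
  intros H. pose proof PI_RGT_0. split; intros s; rewrite ?cos_0, ?sin_0, ?H.
  - lra.
  - auto_derive; [easy | ring].
  - auto_derive; [easy | ring].
  - auto_derive; [easy | ring].
Qed.

Lemma sin_lipschitz a b : Rabs (sin a - sin b) <= Rabs (a - b).
Proof.
  destruct (MVT_abs sin cos b a) as [c [-> _]].
  - intros c _. apply derivable_pt_lim_sin.
  - pose proof (Rabs_pos (a - b)).
    assert (Rabs (cos c) <= 1) by (apply Rabs_le, COS_bound). nra.
Qed.

Lemma cos_lipschitz a b : Rabs (cos a - cos b) <= Rabs (a - b).
Proof. rewrite !cos_sin. replace (a - b) with (PI / 2 + a - (PI / 2 + b)) by ring.
  apply sin_lipschitz. Qed.

Lemma Rabs_mul_sub_le a b c d :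
  Rabs a <= 1 -> Rabs d <= 1 ->
  Rabs (a * b - c * d) <= Rabs (a - c) + Rabs (b - d).
Proof.
  intros Ha Hd. replace (a * b - c * d) with ((a - c) * d + a * (b - d)) by ring.
  eapply Rle_trans; [apply Rabs_triang |]. rewrite !Rabs_mult.
  pose proof (Rabs_pos (a - c)). pose proof (Rabs_pos (b - d)). nra.
Qed.

Lemma Rabs_cos_le_1 a : Rabs (cos a) <= 1.
Proof. apply Rabs_le, COS_bound. Qed.

Lemma Rabs_sin_le_1 a : Rabs (sin a) <= 1.
Proof. apply Rabs_le, SIN_bound. Qed.

(** The right-hand sides are Lipschitz in (u, v, theta), so the squared distance
    [G] of two solutions satisfies |G'| <= 10 G, and Gronwall's argument in both
    time directions applies. *)
Lemma profile_unique u1 v1 th1 u2 v2 th2 (s0 : R) :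
  soliton_profile u1 v1 th1 -> soliton_profile u2 v2 th2 ->
  u1 s0 = u2 s0 -> v1 s0 = v2 s0 -> th1 s0 = th2 s0 ->
  forall s, u1 s = u2 s /\ v1 s = v2 s /\ th1 s = th2 s.
Proof.
  intros H1 H2 Eu Ev Et.
  pose (G := fun s => (u1 s - u2 s) ^ 2 + (v1 s - v2 s) ^ 2 + (th1 s - th2 s) ^ 2).
  pose (G' := fun s =>
    2 * (u1 s - u2 s) * (cos (u1 s) * cos (th1 s) - cos (u2 s) * cos (th2 s)) +
    2 * (v1 s - v2 s) * (sin (th1 s) - sin (th2 s)) +
    2 * (th1 s - th2 s) *
      ((sin (th1 s) * sin (u1 s) - sin (th2 s) * sin (u2 s)) +
       (cos (u1 s) ^ 2 * cos (th1 s) - cos (u2 s) ^ 2 * cos (th2 s)))).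
  assert (HG : forall s, is_derive G s (G' s)).
  { intros s. unfold G. profile_derive H1; profile_derivatives H2.
    unfold G'. ring. }
  assert (HB : forall s, Rabs (G' s) <= 10 * G s).
  { intros s. unfold G', G.
    pose proof (Rabs_mul_sub_le (cos (u1 s)) (cos (th1 s)) (cos (u2 s)) (cos (th2 s))
      (Rabs_cos_le_1 _) (Rabs_cos_le_1 _)) as B1.
    pose proof (Rabs_mul_sub_le (sin (th1 s)) (sin (u1 s)) (sin (th2 s)) (sin (u2 s))
      (Rabs_sin_le_1 _) (Rabs_sin_le_1 _)) as B2.
    pose proof (Rabs_mul_sub_le (cos (u1 s)) (cos (u1 s) * cos (th1 s))
      (cos (u2 s)) (cos (u2 s) * cos (th2 s)) (Rabs_cos_le_1 _)) as B3.
    assert (Rabs (cos (u2 s) * cos (th2 s)) <= 1) as B4.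
    { rewrite Rabs_mult. pose proof (Rabs_cos_le_1 (u2 s)).
      pose proof (Rabs_cos_le_1 (th2 s)). pose proof (Rabs_pos (cos (u2 s))).
      pose proof (Rabs_pos (cos (th2 s))). nra. }
    specialize (B3 B4).
    replace (cos (u1 s) ^ 2 * cos (th1 s)) with (cos (u1 s) * (cos (u1 s) * cos (th1 s))) by ring.
    replace (cos (u2 s) ^ 2 * cos (th2 s)) with (cos (u2 s) * (cos (u2 s) * cos (th2 s))) by ring.
    pose proof (cos_lipschitz (u1 s) (u2 s)). pose proof (sin_lipschitz (u1 s) (u2 s)).
    pose proof (cos_lipschitz (th1 s) (th2 s)). pose proof (sin_lipschitz (th1 s) (th2 s)).
    set (P := cos (u1 s) * cos (th1 s) - cos (u2 s) * cos (th2 s)) in *.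
    set (Q := sin (th1 s) - sin (th2 s)) in *.
    set (S := sin (th1 s) * sin (u1 s) - sin (th2 s) * sin (u2 s)) in *.
    set (T := cos (u1 s) * (cos (u1 s) * cos (th1 s))
      - cos (u2 s) * (cos (u2 s) * cos (th2 s))) in *.
    rewrite <- (pow2_abs (u1 s - u2 s)).
    rewrite <- (pow2_abs (v1 s - v2 s)), <- (pow2_abs (th1 s - th2 s)).
    eapply Rle_trans.
    { eapply Rle_trans; [apply Rabs_triang |].
      apply Rplus_le_compat; [apply Rabs_triang | apply Rle_refl]. }
    rewrite !Rabs_mult, (Rabs_right 2) by lra.
    pose proof (Rabs_triang S T).
    pose proof (Rabs_pos (u1 s - u2 s)). pose proof (Rabs_pos (v1 s - v2 s)).
    pose proof (Rabs_pos (th1 s - th2 s)).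
    set (a := Rabs (u1 s - u2 s)) in *. set (b := Rabs (v1 s - v2 s)) in *.
    set (t := Rabs (th1 s - th2 s)) in *.
    assert (X1 : Rabs P <= a + t) by lra.
    assert (X2 : Rabs Q <= t) by lra.
    assert (X3 : Rabs (S + T) <= 3 * a + 2 * t) by lra.
    apply Rle_trans with (2 * a * (a + t) + 2 * b * t + 2 * t * (3 * a + 2 * t)).
    - repeat apply Rplus_le_compat; apply Rmult_le_compat_l; nra.
    - pose proof (pow2_ge_0 (a - t)). pose proof (pow2_ge_0 (b - t)). nra. }
  assert (G0 : G s0 = 0) by (unfold G; rewrite Eu, Ev, Et; ring).
  assert (HGn : forall s, G s <= 0).
  { intros s. destruct (Rle_dec s0 s) as [Hs | Hs].
    - assert (K : G s * exp (- 10 * s) <= G s0 * exp (- 10 * s0)).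
      { apply (derive_nonpos_ge (fun s => G s * exp (- 10 * s))
          (fun s => (G' s - 10 * G s) * exp (- 10 * s))); [exact Hs | |].
        - intros x _. auto_derive; [exact (ex_intro _ _ (HG x)) |].
          derive_value G x HG. ring.
        - intros x _. specialize (HB x). apply Rabs_le_between in HB.
          pose proof (exp_pos (- 10 * x)). nra. }
      rewrite G0 in K. pose proof (exp_pos (- 10 * s)). nra.
    - assert (K : G s * exp (10 * s) <= G s0 * exp (10 * s0)).
      { apply (derive_nonneg_le (fun s => G s * exp (10 * s))
          (fun s => (G' s + 10 * G s) * exp (10 * s))); [lra | |].
        - intros x _. auto_derive; [exact (ex_intro _ _ (HG x)) |].
          derive_value G x HG. ring.
        - intros x _. specialize (HB x). apply Rabs_le_between in HB.
          pose proof (exp_pos (10 * x)). nra. }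
      rewrite G0 in K. pose proof (exp_pos (10 * s)). nra. }
  intros s. specialize (HGn s). unfold G in HGn.
  pose proof (pow2_ge_0 (u1 s - u2 s)). pose proof (pow2_ge_0 (v1 s - v2 s)).
  pose proof (pow2_ge_0 (th1 s - th2 s)).
  assert (Z : forall x, x ^ 2 <= 0 -> x = 0) by (intros x Hx; nra).
  repeat split; apply Rminus_diag_uniq, Z; lra.
Qed.

(** * The Clairaut function *)

(** Clairaut's first integral of the geodesics of the sphere.  The soliton term
    makes it monotone along the curve. *)
Definition clairaut (u theta : R -> R) (s : R) : R := cos (u s) * sin (theta s).

Lemma clairaut_derive u v theta :
  soliton_profile u v theta -> forall s,
  is_derive (clairaut u theta) s (cos (u s) * (cos (u s) * cos (theta s)) ^ 2).
Proof. intros H s. unfold clairaut. profile_derive H. ring. Qed.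

(** With z = sin u, w = cos u cos theta and L the Clairaut function, the
    arc-length equations become z' = w, w' = - z - L w, L' = w^2 on the unit
    sphere of the (z, w, L)-space. *)
Lemma clairaut_sphere (u theta : R -> R) (s : R) :
  sin (u s) ^ 2 + (cos (u s) * cos (theta s)) ^ 2 + clairaut u theta s ^ 2 = 1.
Proof.
  pose proof (sin2_cos2 (u s)) as E1. pose proof (sin2_cos2 (theta s)) as E2.
  unfold Rsqr in *. unfold clairaut.
  replace (sin (u s) ^ 2 + (cos (u s) * cos (theta s)) ^ 2 + (cos (u s) * sin (theta s)) ^ 2)
    with (sin (u s) * sin (u s) + cos (u s) * cos (u s)
          * (sin (theta s) * sin (theta s) + cos (theta s) * cos (theta s))) by ring.
  rewrite E2. lra.
Qed.

Lemma clairaut_le u v theta (a b : R) :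
  soliton_profile u v theta -> a <= b -> clairaut u theta a <= clairaut u theta b.
Proof.
  intros H Hab. eapply derive_nonneg_le; [exact Hab | |].
  - intros x _. exact (clairaut_derive _ _ _ H x).
  - intros x _. pose proof (profile_cos_pos _ _ _ H x).
    apply Rmult_le_pos; [lra | apply pow2_ge_0].
Qed.

Lemma clairaut_sq_lt_1 u v theta (s : R) :
  soliton_profile u v theta ->
  ~ (u s = 0 /\ cos (theta s) = 0) -> clairaut u theta s ^ 2 < 1.
Proof.
  intros H Hn. pose proof (clairaut_sphere u theta s) as E.
  pose proof (profile_cos_pos _ _ _ H s) as Hc.
  pose proof (sp_latitude _ _ _ H s) as Hu.
  pose proof (pow2_ge_0 (sin (u s))). pose proof (pow2_ge_0 (cos (u s) * cos (theta s))).
  apply Rnot_le_lt. intros Hge. apply Hn.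
  assert (Ez : sin (u s) = 0) by nra.
  assert (Ew : cos (u s) * cos (theta s) = 0) by nra.
  split.
  - apply sin_inj; [lra | lra |]. now rewrite sin_0.
  - apply Rmult_integral in Ew as [Ew | Ew]; [lra | exact Ew].
Qed.

(** The speed of the generating curve is [cos u]. *)
Definition infinite_length (u : R -> R) : Prop :=
  is_lim (fun T => RInt (fun r => cos (u r)) 0 T) p_infty p_infty.

(** If [L] stayed below [m], then z^2 + w^2 = 1 - L^2 would stay above the
    constant [d].  In arc length, (z w - 2 L)' = - w^2 - z^2 - L w z, which is at
    most - (z^2 + w^2) / 2 <= - d / 2 since |L| <= 1.  A bounded function cannot
    decrease like this along an infinite length.  Infinite length excludes
    the curves that run into a pole, where [L] tends to 0. *)
Lemma clairaut_tends_to_1 u v theta (m : R) :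
  soliton_profile u v theta -> infinite_length u ->
  -1 < clairaut u theta 0 -> m < 1 ->
  exists S, forall s, S <= s -> m < clairaut u theta s.
Proof.
  intros H Hlen HL0 Hm. apply NNPP. intros Hn.
  pose proof (fun a b => clairaut_le u v theta a b H) as Hmono.
  set (L := clairaut u theta) in *.
  assert (Hle : forall s, L s <= m).
  { intros s. apply Rnot_lt_le. intros Hs. apply Hn. exists s.
    intros t Ht. specialize (Hmono s t Ht). lra. }
  pose (I := (fun T => RInt (fun r => cos (u r)) 0 T) : R -> R).
  assert (Hcont : forall z, continuous (fun r => cos (u r)) z).
  { intros z. apply (ex_derive_continuous (fun r => cos (u r))).
    auto_derive. eexists. apply (sp_u' _ _ _ H). }
  assert (HI : forall s, is_derive I s (cos (u s))).
  { intros s. apply (is_derive_RInt (fun r => cos (u r)) I 0 s); [| apply Hcont].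
    apply filter_forall. intros b.
    apply (RInt_correct (fun r => cos (u r))), (ex_RInt_continuous (fun r => cos (u r))).
    auto. }
  pose (d := (1 - m) * (1 + L 0)).
  assert (Hd : 0 < d) by (apply Rmult_lt_0_compat; lra).
  pose (F := fun s => sin (u s) * (cos (u s) * cos (theta s)) - 2 * L s + d / 2 * I s).
  assert (HF : forall s, 0 <= s -> F s <= F 0).
  { intros s Hs. eapply derive_nonpos_ge; [exact Hs | |].
    - intros x _. unfold F.
      assert (is_derive (fun s => sin (u s) * (cos (u s) * cos (theta s))) x
        (cos (u x) * ((cos (u x) * cos (theta x)) ^ 2 - sin (u x) ^ 2
           - L x * (cos (u x) * cos (theta x)) * sin (u x)))) as D1.
      { profile_derive H. unfold L, clairaut.
        pose proof (sin2_cos2 (theta x)) as E2. unfold Rsqr in E2.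
        replace (sin (u x) ^ 2) with (sin (u x) ^ 2 *
          (sin (theta x) * sin (theta x) + cos (theta x) * cos (theta x)))
          by (rewrite E2; ring).
        ring. }
      apply (is_derive_plus (fun s => sin (u s) * (cos (u s) * cos (theta s)) - 2 * L s)
        (fun s => d / 2 * I s)).
      + apply (is_derive_minus (fun s => sin (u s) * (cos (u s) * cos (theta s)))
          (fun s => 2 * L s)); [exact D1 |].
        apply (is_derive_scal L), (clairaut_derive _ _ _ H).
      + apply (is_derive_scal I), HI.
    - intros x [Hx _]. unfold minus, plus, opp, scal, mult; simpl.
      unfold mult; simpl.
      pose proof (profile_cos_pos _ _ _ H x) as Hc.
      pose proof (clairaut_sphere u theta x) as E. fold L in E.
      pose proof (Hmono 0 x Hx) as Hmon.
      pose proof (Hle x) as HLm.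
      set (c := cos (u x)) in *. set (z := sin (u x)) in *.
      set (w := c * cos (theta x)) in *. set (l := L x) in *.
      assert (Hzw : - (l * w * z) <= (z ^ 2 + w ^ 2) / 2).
      { assert (-1 <= l <= 1) by (split; nra).
        pose proof (pow2_ge_0 (z + w)). pose proof (pow2_ge_0 (z - w)).
        destruct (Rle_dec 0 (w * z)); nra. }
      assert (d <= z ^ 2 + w ^ 2).
      { unfold d. replace (z ^ 2 + w ^ 2) with ((1 - l) * (1 + l)) by nra.
        apply Rmult_le_compat; lra. }
      replace (c * (w * (w * 1) - z * (z * 1) - l * w * z) + - (2 * (c * (w * (w * 1)))) + d / 2 * c)
        with (c * (- w ^ 2 - z ^ 2 - l * w * z + d / 2)) by field.
      nra. }
  (* |z w - 2 L| <= 3, so an arc of length more than 12 / d is too long. *)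
  destruct (is_lim_p_infty_spec _ Hlen (12 / d)) as [T HT].
  specialize (HT (Rmax (T + 1) 0) ltac:(pose proof (Rmax_l (T + 1) 0); lra)).
  specialize (HF (Rmax (T + 1) 0) (Rmax_r _ _)).
  set (s := Rmax (T + 1) 0) in *. fold (I s) in HT.
  unfold F in HF.
  assert (HI0 : I 0 = 0) by exact (RInt_point 0 (fun r => cos (u r))).
  rewrite HI0 in HF.
  assert (Hb : forall s, -1 <= sin (u s) * (cos (u s) * cos (theta s)) <= 1 /\ -1 <= L s <= 1).
  { intros t. pose proof (clairaut_sphere u theta t) as E. fold L in E.
    set (z := sin (u t)) in *. set (w := cos (u t) * cos (theta t)) in *.
    pose proof (pow2_ge_0 (z + w)). pose proof (pow2_ge_0 (z - w)). split; split; nra. }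
  pose proof (Hb s). pose proof (Hb 0).
  assert (6 < d / 2 * I s).
  { apply Rmult_lt_reg_l with (2 / d); [apply Rdiv_lt_0_compat; lra |].
    replace (2 / d * (d / 2 * I s)) with (I s) by (field; lra).
    replace (2 / d * 6) with (12 / d) by (field; lra). exact HT. }
  lra.
Qed.

Lemma clairaut_sin_bound u v theta (m s : R) :
  soliton_profile u v theta -> 0 <= m -> m < clairaut u theta s ->
  m < sin (theta s) /\ m < cos (u s).
Proof.
  intros H Hm HL. unfold clairaut in HL.
  pose proof (profile_cos_pos _ _ _ H s). pose proof (COS_bound (u s)).
  pose proof (SIN_bound (theta s)).
  assert (0 < sin (theta s)) by nra. split; nra.
Qed.

(** v' = sin theta = L / cos u >= L, which is eventually above 1 / 2. *)
Lemma longitude_tends_to_infinity u v theta :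
  soliton_profile u v theta -> infinite_length u -> -1 < clairaut u theta 0 ->
  is_lim v p_infty p_infty.
Proof.
  intros H Hlen HL0.
  destruct (clairaut_tends_to_1 _ _ _ (1 / 2) H Hlen HL0 ltac:(lra)) as [S HS].
  apply is_lim_spec. intros M.
  exists (Rmax S (S + 2 * (M - v S))). intros s Hs.
  pose proof (Rmax_l S (S + 2 * (M - v S))).
  pose proof (Rmax_r S (S + 2 * (M - v S))).
  destruct (mean_value v (fun s => sin (theta s)) S s ltac:(lra)) as [c [Hc E]].
  { intros x _. apply (sp_v' _ _ _ H). }
  destruct (clairaut_sin_bound _ _ _ (1 / 2) c H ltac:(lra) (HS c ltac:(lra))).
  nra.
Qed.

Lemma latitude_tends_to_0 u v theta :
  soliton_profile u v theta -> infinite_length u -> -1 < clairaut u theta 0 ->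
  is_lim u p_infty 0.
Proof.
  intros H Hlen HL0.
  assert (Hsin : is_lim (fun s => sin (u s)) p_infty 0).
  { apply is_lim_spec. intros eps. pose proof (cond_pos eps) as He.
    assert (Hp : 0 < Rmin eps 1) by (apply Rmin_glb_lt; lra).
    pose proof (Rmin_l eps 1). pose proof (Rmin_r eps 1).
    set (e := Rmin eps 1) in *.
    destruct (clairaut_tends_to_1 _ _ _ (1 - e ^ 2 / 2) H Hlen HL0 ltac:(nra)) as [S HS].
    exists S. intros s Hs. specialize (HS s ltac:(lra)).
    pose proof (clairaut_sphere u theta s) as E.
    rewrite Rminus_0_r. apply Rlt_le_trans with e; [| lra].
    pose proof (pow2_ge_0 (cos (u s) * cos (theta s))).
    assert (clairaut u theta s <= 1) by nra.
    apply Rabs_def1; nra. }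
  apply is_lim_ext with (fun s => asin (sin (u s))).
  { intros s. apply asin_sin. pose proof (sp_latitude _ _ _ H s). lra. }
  rewrite <- asin_0. apply is_lim_comp_continuous; [exact Hsin |].
  apply continuity_pt_filterlim, derivable_continuous_pt.
  apply derivable_pt_asin. lra.
Qed.

(** * The ends as graphs over the axis *)

(** The derivative of y = tan u with respect to the longitude.  Great circles
    are sinusoids in these coordinates (y'' = - y), so that the soliton equation
    becomes y'' = - y - damping y y'. *)
Definition slope (u theta : R -> R) (s : R) : R :=
  cos (theta s) / (cos (u s) * sin (theta s)).

(** [damping y p] is cos u cos theta / (sin theta)^3 written in terms of
    y = tan u and p = dy / dv. *)
Definition damping (y p : R) : R := p * (1 + y ^ 2 + p ^ 2) / (1 + y ^ 2) ^ 2.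

Lemma slope_derive u v theta (s : R) :
  soliton_profile u v theta -> sin (theta s) <> 0 ->
  is_derive (slope u theta) s
    (sin (theta s) * (- tan (u s) - damping (tan (u s)) (slope u theta s))).
Proof.
  intros H Hs. pose proof (profile_cos_pos _ _ _ H s) as Hc.
  pose proof (sin2_cos2 (u s)) as E1. pose proof (sin2_cos2 (theta s)) as E2.
  unfold Rsqr in *.
  assert (Hd : damping (tan (u s)) (slope u theta s)
    = cos (u s) * cos (theta s) / sin (theta s) ^ 3).
  { unfold damping, slope, tan.
    replace (1 + (sin (u s) / cos (u s)) ^ 2) with (/ cos (u s) ^ 2).
    2:{ apply Rmult_eq_reg_r with (cos (u s) ^ 2); [| nra].
        field_simplify; [| lra | lra]. rewrite <- E1. ring. }
    replace (/ cos (u s) ^ 2 + (cos (theta s) / (cos (u s) * sin (theta s))) ^ 2)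
      with (/ (cos (u s) ^ 2 * sin (theta s) ^ 2)).
    2:{ transitivity ((sin (theta s) * sin (theta s) + cos (theta s) * cos (theta s))
          / (cos (u s) ^ 2 * sin (theta s) ^ 2)).
        - rewrite E2. field. split; [exact Hs | lra].
        - field. split; [exact Hs | lra]. }
    field. split; [exact Hs | lra]. }
  rewrite Hd. unfold slope.
  auto_derive.
  - repeat split; profile_derivatives H.
    apply Rmult_integral_contrapositive. split; [lra | exact Hs].
  - profile_derivatives H. unfold tan.
    transitivity ((- cos (u s) * (sin (theta s) * sin (theta s) + cos (theta s) * cos (theta s))
       * (sin (theta s) * sin (u s) + cos (u s) ^ 2 * cos (theta s))
       + cos (u s) * sin (u s) * sin (theta s) * (cos (theta s) * cos (theta s)))
       / (cos (u s) ^ 2 * sin (theta s) ^ 2)).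
    { field. split; [exact Hs | lra]. }
    replace (cos (theta s) * cos (theta s)) with (1 - sin (theta s) * sin (theta s)) by lra.
    field. split; [exact Hs | lra].
Qed.

(** [damping] is [p] up to terms of third order, so near the origin the
    difference of two solutions obeys a small perturbation of
    [D'' + D' + D = 0]. *)
Lemma damping_near_0 (y1 p1 y2 p2 : R) :
  Rabs y1 <= / 10 -> Rabs p1 <= / 10 -> Rabs y2 <= / 10 -> Rabs p2 <= / 10 ->
  Rabs (p1 - p2 - (damping y1 p1 - damping y2 p2))
  <= / 10 * (Rabs (y1 - y2) + Rabs (p1 - p2)).
Proof.
  intros Hy1 Hp1 Hy2 Hp2.
  pose (m1 := / (1 + y1 ^ 2)). pose (m2 := / (1 + y2 ^ 2)).
  assert (D1 : damping y1 p1 = p1 * m1 + p1 ^ 3 * m1 ^ 2)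
    by (unfold damping, m1; field; nra).
  assert (D2 : damping y2 p2 = p2 * m2 + p2 ^ 3 * m2 ^ 2)
    by (unfold damping, m2; field; nra).
  assert (M : forall y, 0 < / (1 + y ^ 2) <= 1).
  { intros y. split; [apply Rinv_0_lt_compat; nra |].
    rewrite <- Rinv_1. apply Rinv_le_contravar; nra. }
  assert (M1 : 0 < m1 <= 1) by apply M. assert (M2 : 0 < m2 <= 1) by apply M.
  assert (E1 : m1 - 1 = - (y1 * y1 * m1)) by (unfold m1; field; nra).
  assert (E12 : m1 - m2 = (y1 - y2) * (- (y1 + y2) * (m1 * m2)))
    by (unfold m1, m2; field; split; nra).
  rewrite D1, D2. clear D1 D2. clearbody m1 m2.
  replace (p1 - p2 - (p1 * m1 + p1 ^ 3 * m1 ^ 2 - (p2 * m2 + p2 ^ 3 * m2 ^ 2)))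
    with ((p1 - p2) * (- (m1 - 1) - (p1 * p1 + p1 * p2 + p2 * p2) * (m1 * m1))
      + (m1 - m2) * (- p2 - p2 * p2 * p2 * (m1 + m2))) by ring.
  rewrite E1, E12.
  replace ((y1 - y2) * (- (y1 + y2) * (m1 * m2)) * (- p2 - p2 * p2 * p2 * (m1 + m2)))
    with ((y1 - y2) * ((y1 + y2) * (m1 * m2) * (p2 + p2 * p2 * p2 * (m1 + m2)))) by ring.
  eapply Rle_trans; [apply Rabs_triang |]. rewrite !(Rabs_mult (p1 - p2)), !(Rabs_mult (y1 - y2)).
  assert (Hsmall : forall a b, Rabs a <= / 10 -> Rabs b <= / 10 -> - / 100 <= a * b <= / 100).
  { intros a b Ha Hb. apply Rabs_le_between.
    rewrite Rabs_mult. pose proof (Rabs_pos a). pose proof (Rabs_pos b). nra. }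
  assert (B1 : Rabs (- - (y1 * y1 * m1) - (p1 * p1 + p1 * p2 + p2 * p2) * (m1 * m1)) <= / 10).
  { pose proof (Hsmall y1 y1 Hy1 Hy1). pose proof (Hsmall p1 p1 Hp1 Hp1).
    pose proof (Hsmall p1 p2 Hp1 Hp2). pose proof (Hsmall p2 p2 Hp2 Hp2).
    assert (0 <= m1 * m1 <= 1) by nra.
    assert (0 <= y1 * y1) by nra.
    assert (0 <= p1 * p1 + p1 * p2 + p2 * p2) by (pose proof (pow2_ge_0 (p1 + p2)); nra).
    apply Rabs_le. split; nra. }
  assert (B2 : Rabs ((y1 + y2) * (m1 * m2) * (p2 + p2 * p2 * p2 * (m1 + m2))) <= / 10).
  { apply Rabs_le_between in Hy1, Hy2.
    assert (0 <= m1 * m2 <= 1) by nra.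
    assert (Q1 : Rabs (y1 + y2) <= / 5) by (apply Rabs_le; lra).
    assert (Q2 : Rabs (p2 + p2 * p2 * p2 * (m1 + m2)) <= / 5).
    { replace (p2 + p2 * p2 * p2 * (m1 + m2)) with (p2 * (1 + p2 * p2 * (m1 + m2))) by ring.
      pose proof (Hsmall p2 p2 Hp2 Hp2). assert (0 <= p2 * p2) by nra.
      rewrite Rabs_mult. rewrite (Rabs_right (1 + _)) by (apply Rle_ge; nra).
      pose proof (Rabs_pos p2). assert (p2 * p2 * (m1 + m2) <= / 50) by nra. nra. }
    rewrite !Rabs_mult, (Rabs_right m1), (Rabs_right m2) by lra.
    pose proof (Rabs_pos (y1 + y2)).
    pose proof (Rabs_pos (p2 + p2 * p2 * p2 * (m1 + m2))).
    assert (Rabs (y1 + y2) * (m1 * m2) <= / 5) by nra. nra. }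
  pose proof (Rabs_pos (y1 - y2)). pose proof (Rabs_pos (p1 - p2)). nra.
Qed.

(** On [S, +oo) the curve is a graph over the axis, [psi] giving the parameter
    as a function of the longitude, and it is so close to the axis that
    [damping_near_0] applies. *)
Record graph_end (u v theta : R -> R) (S : R) (psi : R -> R) : Prop := {
  ge_profile : soliton_profile u v theta;
  ge_sin_pos : forall s, S <= s -> 0 < sin (theta s);
  ge_tan_small : forall s, S <= s -> Rabs (tan (u s)) <= / 10;
  ge_slope_small : forall s, S <= s -> Rabs (slope u theta s) <= / 10;
  ge_above : forall x, v S < x -> S < psi x;
  ge_right_inverse : forall x, v S < x -> v (psi x) = x;
  ge_inverse_derive : forall x, v S < x -> is_derive psi x (/ sin (theta (psi x)))
}.

Lemma graph_end_exists u v theta (S0 : R) :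
  soliton_profile u v theta -> infinite_length u -> -1 < clairaut u theta 0 ->
  exists S psi, S0 <= S /\ graph_end u v theta S psi.
Proof.
  intros H Hlen HL0.
  destruct (clairaut_tends_to_1 _ _ _ (999 / 1000) H Hlen HL0 ltac:(lra)) as [S1 HS1].
  pose (S := Rmax S0 S1).
  assert (HS : forall s, S <= s -> 999 / 1000 < clairaut u theta s).
  { intros s Hs. apply HS1. pose proof (Rmax_r S0 S1). unfold S in Hs. lra. }
  assert (Hb : forall s, S <= s -> 999 / 1000 < sin (theta s) /\ 999 / 1000 < cos (u s)).
  { intros s Hs. apply (clairaut_sin_bound u v theta); [exact H | lra | exact (HS s Hs)]. }
  assert (Hzw : forall s, S <= s ->
    Rabs (sin (u s)) <= / 20 /\ Rabs (cos (u s) * cos (theta s)) <= / 20).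
  { intros s Hs. pose proof (HS s Hs). pose proof (clairaut_sphere u theta s).
    pose proof (pow2_ge_0 (sin (u s))).
    pose proof (pow2_ge_0 (cos (u s) * cos (theta s))).
    assert (998 / 1000 <= clairaut u theta s ^ 2) by nra.
    split; apply Rabs_le; split; nra. }
  assert (Hquot : forall a b, Rabs a <= / 20 -> 99 / 100 <= b -> Rabs (a / b) <= / 10).
  { intros a b Ha Hb'. unfold Rdiv. rewrite Rabs_mult, Rabs_inv, (Rabs_right b) by lra.
    apply Rmult_le_reg_r with b; [lra |]. rewrite Rmult_assoc, Rinv_l by lra. lra. }
  destruct (increasing_inverse v (fun s => sin (theta s)) S) as [psi Hpsi].
  - apply (sp_v' _ _ _ H).
  - intros s Hs. destruct (Hb s ltac:(lra)). lra.
  - exact (longitude_tends_to_infinity _ _ _ H Hlen HL0).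
  - exists S, psi. split; [apply Rmax_l |]. split.
    + exact H.
    + intros s Hs. destruct (Hb s Hs). lra.
    + intros s Hs. destruct (Hb s Hs), (Hzw s Hs). apply Hquot; lra.
    + intros s Hs. destruct (Hb s Hs), (Hzw s Hs). unfold slope.
      replace (cos (theta s) / (cos (u s) * sin (theta s)))
        with (cos (u s) * cos (theta s) / (cos (u s) * (cos (u s) * sin (theta s))))
        by (field; lra).
      apply Hquot; [lra |].
      pose proof (HS s Hs) as HL. unfold clairaut in HL.
      apply Rle_trans with (999 / 1000 * (999 / 1000)); [lra |].
      apply Rmult_le_compat; lra.
    + intros x Hx. apply (Hpsi x Hx).
    + intros x Hx. apply (Hpsi x Hx).
    + intros x Hx. apply (Hpsi x Hx).
Qed.

Lemma graph_end_injective u v theta S psi :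
  graph_end u v theta S psi -> forall s t, S <= s -> S <= t -> v s = v t -> s = t.
Proof.
  intros G.
  assert (Hlt : forall s t, S <= s -> s < t -> v s < v t).
  { intros s t Hs Hst. apply (derive_pos_lt v (fun s => sin (theta s))); [exact Hst | |].
    - intros x _. apply (sp_v' _ _ _ (ge_profile _ _ _ _ _ G)).
    - intros x Hx. apply (ge_sin_pos _ _ _ _ _ G). lra. }
  intros s t Hs Ht E. destruct (Rtotal_order s t) as [Hst | [Hst | Hst]]; [| exact Hst |].
  - specialize (Hlt s t Hs Hst). lra.
  - specialize (Hlt t s Ht Hst). lra.
Qed.

Lemma graph_end_tan_derive u v theta S psi (x : R) :
  graph_end u v theta S psi -> v S < x ->
  is_derive (fun x => tan (u (psi x))) x (slope u theta (psi x)).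
Proof.
  intros G Hx. pose proof (ge_profile _ _ _ _ _ G) as H.
  pose proof (profile_cos_pos _ _ _ H (psi x)) as Hc.
  pose proof (ge_sin_pos _ _ _ _ _ G (psi x)
    (Rlt_le _ _ (ge_above _ _ _ _ _ G x Hx))) as Hs.
  replace (slope u theta (psi x)) with
    (scal (/ sin (theta (psi x)))
       (scal (cos (u (psi x)) * cos (theta (psi x))) (tan (u (psi x)) ^ 2 + 1))).
  - apply (is_derive_comp (fun s => tan (u s)) psi).
    + apply (is_derive_comp tan u); [apply is_derive_tan; lra | apply (sp_u' _ _ _ H)].
    + apply (ge_inverse_derive _ _ _ _ _ G x Hx).
  - unfold scal; simpl; unfold mult; simpl. unfold slope, tan.
    pose proof (sin2_cos2 (u (psi x))) as E. unfold Rsqr in E.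
    transitivity (cos (theta (psi x)) *
      (sin (u (psi x)) * sin (u (psi x)) + cos (u (psi x)) * cos (u (psi x)))
      / (cos (u (psi x)) * sin (theta (psi x)))).
    + field. lra.
    + rewrite E. field. lra.
Qed.

Lemma graph_end_slope_derive u v theta S psi (x : R) :
  graph_end u v theta S psi -> v S < x ->
  is_derive (fun x => slope u theta (psi x)) x
    (- tan (u (psi x)) - damping (tan (u (psi x))) (slope u theta (psi x))).
Proof.
  intros G Hx. pose proof (ge_profile _ _ _ _ _ G) as H.
  pose proof (ge_sin_pos _ _ _ _ _ G (psi x)
    (Rlt_le _ _ (ge_above _ _ _ _ _ G x Hx))) as Hs.
  replace (- tan (u (psi x)) - damping (tan (u (psi x))) (slope u theta (psi x))) with
    (scal (/ sin (theta (psi x))) (sin (theta (psi x)) *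
       (- tan (u (psi x)) - damping (tan (u (psi x))) (slope u theta (psi x))))).
  - apply (is_derive_comp (slope u theta) psi).
    + apply (slope_derive u v theta); [exact H | lra].
    + apply (ge_inverse_derive _ _ _ _ _ G x Hx).
  - unfold scal; simpl; unfold mult; simpl. field. lra.
Qed.

(** Both ends solve the same second-order equation in the longitude, so their
    difference oscillates.  For the two ends of one curve this gives
    self-intersections, and for an end and the equator it gives zeros of [u]. *)
Lemma graph_ends_cross u1 v1 th1 S1 psi1 u2 v2 th2 S2 psi2 (M : R) :
  graph_end u1 v1 th1 S1 psi1 -> graph_end u2 v2 th2 S2 psi2 ->
  exists x, M < x /\ v1 S1 < x /\ v2 S2 < x /\ u1 (psi1 x) = u2 (psi2 x).
Proof.
  intros G1 G2.
  pose (V := Rmax M (Rmax (v1 S1) (v2 S2))).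
  assert (HV : forall x, V < x -> M < x /\ v1 S1 < x /\ v2 S2 < x).
  { intros x Hx. unfold V in Hx.
    pose proof (Rmax_l M (Rmax (v1 S1) (v2 S2))). pose proof (Rmax_r M (Rmax (v1 S1) (v2 S2))).
    pose proof (Rmax_l (v1 S1) (v2 S2)). pose proof (Rmax_r (v1 S1) (v2 S2)). lra. }
  pose (y1 := fun x => tan (u1 (psi1 x))). pose (p1 := fun x => slope u1 th1 (psi1 x)).
  pose (y2 := fun x => tan (u2 (psi2 x))). pose (p2 := fun x => slope u2 th2 (psi2 x)).
  destruct (damped_oscillator_has_zero (fun x => y1 x - y2 x) (fun x => p1 x - p2 x)
    (fun x => p1 x - p2 x - (damping (y1 x) (p1 x) - damping (y2 x) (p2 x))) V)
    as [x [Hx E]].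
  - intros x Hx. destruct (HV x Hx) as [_ [Hx1 Hx2]]. split; [| split].
    + apply (is_derive_minus y1 y2).
      * exact (graph_end_tan_derive _ _ _ _ _ _ G1 Hx1).
      * exact (graph_end_tan_derive _ _ _ _ _ _ G2 Hx2).
    + replace (- (y1 x - y2 x) - (p1 x - p2 x)
         + (p1 x - p2 x - (damping (y1 x) (p1 x) - damping (y2 x) (p2 x))))
        with (minus (- y1 x - damping (y1 x) (p1 x)) (- y2 x - damping (y2 x) (p2 x)))
        by (unfold minus, plus, opp; simpl; ring).
      apply (is_derive_minus p1 p2).
      * exact (graph_end_slope_derive _ _ _ _ _ _ G1 Hx1).
      * exact (graph_end_slope_derive _ _ _ _ _ _ G2 Hx2).
    + pose proof (ge_above _ _ _ _ _ G1 x Hx1). pose proof (ge_above _ _ _ _ _ G2 x Hx2).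
      apply damping_near_0.
      * apply (ge_tan_small _ _ _ _ _ G1). lra.
      * apply (ge_slope_small _ _ _ _ _ G1). lra.
      * apply (ge_tan_small _ _ _ _ _ G2). lra.
      * apply (ge_slope_small _ _ _ _ _ G2). lra.
  - exists x. destruct (HV x Hx) as [HM [Hx1 Hx2]].
    repeat split; [exact HM | exact Hx1 | exact Hx2 |].
    pose proof (sp_latitude _ _ _ (ge_profile _ _ _ _ _ G1) (psi1 x)).
    pose proof (sp_latitude _ _ _ (ge_profile _ _ _ _ _ G2) (psi2 x)).
    apply tan_inj; unfold y1, y2 in E; lra.
Qed.

Lemma equator_graph_end : graph_end (fun _ => 0) (fun s => s) (fun _ => PI / 2) 0 (fun x => x).
Proof.
  split; try (intros; assumption || reflexivity).
  - split; intros s; rewrite ?cos_PI2, ?sin_PI2, ?sin_0.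
    + pose proof PI_RGT_0. lra.
    + auto_derive; [easy | ring].
    + auto_derive; [easy | ring].
    + auto_derive; [easy | ring].
  - intros s _. rewrite sin_PI2. lra.
  - intros s _. rewrite tan_0, Rabs_R0. lra.
  - intros s _. unfold slope. rewrite cos_PI2. unfold Rdiv. rewrite Rmult_0_l, Rabs_R0. lra.
  - intros x _. rewrite sin_PI2. auto_derive; [easy | field].
Qed.

(** * Crossings are transversal *)

(** If the curve met itself with opposite directions, uniqueness would identify
    it with its own reversal about the midpoint of the two parameters; at the
    midpoint the direction would then be its own opposite. *)
Lemma no_tangential_crossing u v theta (s1 s2 : R) :
  soliton_profile u v theta -> u s1 = u s2 -> v s1 = v s2 ->
  0 < sin (theta s1) -> sin (theta s2) < 0 ->
  cos (theta s1) * sin (theta s2) <> cos (theta s2) * sin (theta s1).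
Proof.
  intros H Eu Ev Hs1 Hs2 E.
  pose (k := theta s1 - theta s2).
  assert (Hsk : sin k = 0) by (unfold k; rewrite sin_minus; lra).
  assert (Hck : cos k = -1).
  { pose proof (sin2_cos2 k) as Ek. rewrite Hsk in Ek. unfold Rsqr in Ek.
    assert (Et : sin (theta s1) = sin (theta s2) * cos k).
    { replace (theta s1) with (theta s2 + k) by (unfold k; ring).
      rewrite sin_plus, Hsk. ring. }
    assert (Hf : (cos k - 1) * (cos k + 1) = 0) by nra.
    apply Rmult_integral in Hf as [Hf | Hf]; [exfalso | lra].
    replace (cos k) with 1 in Et by lra. lra. }
  destruct (profile_unique _ _ _ _ _ _ s1 H
    (profile_reverse _ _ _ (s1 + s2) k H Hsk Hck)) with (s := (s1 + s2) / 2)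
    as [_ [_ Et]].
  - now replace (s1 + s2 - s1) with s2 by ring.
  - now replace (s1 + s2 - s1) with s2 by ring.
  - replace (s1 + s2 - s1) with s2 by ring. unfold k. ring.
  - replace (s1 + s2 - (s1 + s2) / 2) with ((s1 + s2) / 2) in Et by field.
    assert (k = 0) as Hk by lra. rewrite Hk, cos_0 in Hck. lra.
Qed.

(** The points of the sphere determine the longitude up to multiples of 2 PI,
    hence completely among longitudes at distance less than 2. *)
Lemma Psi_eq_close u v (s t s' t' : R) :
  (forall s, - (PI / 2) < u s < PI / 2) -> Rabs (v s - v s') < 2 ->
  Psi u v s t = Psi u v s' t' -> u s = u s' /\ v s = v s'.
Proof.
  intros Hu Hv E. unfold Psi in E. injection E as Ex Ey Ez _.
  assert (Eu : u s = u s').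
  { apply sin_inj; [pose proof (Hu s); lra | pose proof (Hu s'); lra | exact Ez]. }
  split; [exact Eu |]. rewrite <- Eu in Ex, Ey.
  assert (Hc : 0 < cos (u s)) by (destruct (Hu s); now apply cos_gt_0).
  apply Rmult_eq_reg_l in Ex; [| lra]. apply Rmult_eq_reg_l in Ey; [| lra].
  set (h := (v s - v s') / 2).
  assert (Hh : sin h * sin h = 0).
  { assert (C : cos (2 * h) = 1).
    { unfold h. replace (2 * ((v s - v s') / 2)) with (v s - v s') by field.
      rewrite cos_minus, Ex, Ey. pose proof (sin2_cos2 (v s')). unfold Rsqr in *. lra. }
    rewrite cos_2a_sin in C. lra. }
  assert (Hsh : sin h = 0) by nra.
  assert (Hh1 : Rabs h < 1).
  { unfold h, Rdiv. rewrite Rabs_mult, (Rabs_right (/ 2)) by lra. lra. }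
  apply Rabs_def2 in Hh1. pose proof PI2_1.
  assert (h = 0) as Hh0.
  { apply sin_inj; [lra | lra |]. now rewrite sin_0. }
  unfold h in Hh0. lra.
Qed.

(** If the sheets through a crossing coincided, then the two graphs over the
    axis would agree near [x], so they would be tangent there. *)
Lemma not_embedded_of_crossing u v theta S1 psi1 S2 psi2 (x : R) :
  let urev := fun s => u (0 - s) in
  let vrev := fun s => v (0 - s) in
  graph_end u v theta S1 psi1 ->
  graph_end urev vrev (fun s => theta (0 - s) + PI) S2 psi2 ->
  v S1 < x -> vrev S2 < x -> u (psi1 x) = urev (psi2 x) ->
  ~ embedded (Psi u v).
Proof.
  intros urev vrev G1 G2 Hx1 Hx2 E Hemb.
  pose proof (ge_profile _ _ _ _ _ G1) as H.
  pose (threv := fun s => theta (0 - s) + PI). fold threv in G2.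
  pose (s1 := psi1 x). pose (s2 := 0 - psi2 x).
  assert (Ev1 : v s1 = x) by apply (ge_right_inverse _ _ _ _ _ G1 x Hx1).
  assert (Ev2 : v s2 = x) by apply (ge_right_inverse _ _ _ _ _ G2 x Hx2).
  assert (Eu : u s1 = u s2) by exact E.
  assert (EX : Psi u v s1 0 = Psi u v s2 0) by (unfold Psi; now rewrite Eu, Ev1, Ev2).
  pose proof (ge_above _ _ _ _ _ G1 x Hx1) as Hs1.
  pose proof (ge_above _ _ _ _ _ G2 x Hx2) as Hs2.
  assert (Hcv : continuous v s1).
  { apply (ex_derive_continuous v). eexists. apply (sp_v' _ _ _ H). }
  (* On this neighbourhood of the first sheet the longitude is injective and is
     determined by the point of the sphere. *)
  assert (HU : locally (s1, 0) (fun p : R * R => S1 < fst p /\ Rabs (v (fst p) - x) < 1)).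
  { assert (L : locally s1 (fun s => S1 < s /\ Rabs (v s - x) < 1)).
    { apply filter_and.
      - now apply (open_gt S1).
      - assert (P1 : 0 < 1) by lra.
        rewrite <- Ev1. apply (Hcv (fun y => Rabs (y - v s1) < 1)).
        exists (mkposreal 1 P1). intros y Hy. exact Hy. }
    destruct L as [e He]. exists e. intros [a b] [Ha _]. exact (He a Ha). }
  specialize (Hemb s1 0 s2 0 EX _ HU).
  assert (Hloc : locally x (fun x' => tan (urev (psi2 x')) = tan (u (psi1 x')))).
  { destruct Hemb as [e He].
    assert (Hcp : continuous psi2 x).
    { apply (ex_derive_continuous psi2). eexists. apply (ge_inverse_derive _ _ _ _ _ G2 x Hx2). }
    assert (L : locally x (fun x' => ball (psi2 x) e (psi2 x') /\
        (Rabs (x' - x) < 1 /\ (v S1 < x' /\ vrev S2 < x')))).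
    { assert (P1 : 0 < 1) by lra.
      apply filter_and; [| apply filter_and; [| apply filter_and]].
      - apply (Hcp (ball (psi2 x) e)). exists e. auto.
      - exists (mkposreal 1 P1). intros y Hy. exact Hy.
      - now apply (open_gt (v S1)).
      - now apply (open_gt (vrev S2)). }
    revert L. apply filter_imp. intros x' [Hb [Hxx [Hx1' Hx2']]].
    destruct (He (0 - psi2 x', 0)) as [[s t] [[Hs Hv] EP]].
    { split; [| apply ball_center]. simpl. unfold s2.
      unfold ball in *; simpl in *; unfold AbsRing_ball, abs, minus, plus, opp in *; simpl in *.
      replace (0 - psi2 x' + - (0 - psi2 x)) with (- (psi2 x' + - psi2 x)) by ring.
      now rewrite Rabs_Ropp. }
    simpl in Hs, Hv, EP.
    assert (Ev' : v (0 - psi2 x') = x') by exact (ge_right_inverse _ _ _ _ _ G2 x' Hx2').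
    destruct (Psi_eq_close u v s t (0 - psi2 x') 0) as [Eu' Ev''].
    - apply (sp_latitude _ _ _ H).
    - rewrite Ev'. apply Rabs_def2 in Hv, Hxx. apply Rabs_def1; lra.
    - exact EP.
    - assert (Es : s = psi1 x').
      { apply (graph_end_injective _ _ _ _ _ G1); [lra | |].
        - left. exact (ge_above _ _ _ _ _ G1 x' Hx1').
        - rewrite (ge_right_inverse _ _ _ _ _ G1 x' Hx1'). lra. }
      rewrite <- Es. unfold urev. now rewrite Eu'. }
  assert (Hslope : slope u theta (psi1 x) = slope urev threv (psi2 x)).
  { pose proof (graph_end_tan_derive _ _ _ _ _ _ G1 Hx1) as D1.
    pose proof (graph_end_tan_derive _ _ _ _ _ _ G2 Hx2) as D2.
    apply (is_derive_ext_loc _ _ _ _ Hloc) in D2.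
    rewrite <- (is_derive_unique _ _ _ D1). now apply is_derive_unique. }
  pose proof (ge_sin_pos _ _ _ _ _ G1 (psi1 x) ltac:(lra)) as Hp1.
  pose proof (ge_sin_pos _ _ _ _ _ G2 (psi2 x) ltac:(lra)) as Hp2.
  unfold threv in Hp2. rewrite neg_sin in Hp2.
  apply (no_tangential_crossing u v theta s1 s2 H); [exact Eu | lra | exact Hp1 | unfold s2; lra |].
  unfold slope, threv in Hslope. rewrite neg_sin, neg_cos in Hslope. unfold urev in Hslope.
  fold s1 s2 in Hslope, Hp1, Hp2.
  pose proof (profile_cos_pos _ _ _ H s1) as Hc. rewrite <- Eu in Hslope.
  apply Rmult_eq_reg_r with (/ (cos (u s1) * sin (theta s1) * - sin (theta s2))).
  2:{ apply Rinv_neq_0_compat. repeat apply Rmult_integral_contrapositive_currified; lra. }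
  transitivity (- (cos (theta s1) / (cos (u s1) * sin (theta s1)))).
  - field. lra.
  - rewrite Hslope. field. lra.
Qed.

(** * Symmetry and distance to the cylinder *)

Lemma symmetric_of_initial_conditions u v theta :
  soliton_profile u v theta -> u 0 = 0 -> theta 0 = 0 ->
  forall s, u (- s) = - u s /\ v (- s) = v s.
Proof.
  intros H Hu Ht s.
  destruct (profile_unique _ _ _ _ _ _ 0 H (profile_reflect _ _ _ H)) with (s := s)
    as [Eu [Ev _]]; rewrite ?Ropp_0, ?Hu, ?Ht, ?Ropp_0; auto.
  split; lra.
Qed.

(** On an interval where [L = 0] one has w = 0 too, hence |sin u| = 1, which only
    happens at the poles. *)
Lemma clairaut_pos_after_zero u v theta (a s : R) :
  soliton_profile u v theta -> clairaut u theta a = 0 -> a < s -> 0 < clairaut u theta s.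
Proof.
  intros H Ha Hs. apply Rnot_le_lt. intros Hn.
  assert (Hz : forall x, a <= x <= s -> clairaut u theta x = 0).
  { intros x Hx. pose proof (clairaut_le _ _ _ _ _ H (proj1 Hx)).
    pose proof (clairaut_le _ _ _ _ _ H (proj2 Hx)). lra. }
  pose (m := (a + s) / 2).
  pose proof (profile_cos_pos _ _ _ H m) as Hc.
  assert (D : is_derive (clairaut u theta) m 0).
  { apply is_derive_ext_loc with (fun _ => 0).
    - apply filter_imp with (fun x => a < x /\ x < s).
      + intros x Hx. symmetry. apply Hz. lra.
      + apply filter_and; [apply (open_gt a) | apply (open_lt s)]; unfold m; lra.
    - apply (is_derive_const 0). }
  apply is_derive_unique in D.
  rewrite (is_derive_unique _ _ _ (clairaut_derive _ _ _ H m)) in D.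
  assert (Ec : cos (theta m) = 0).
  { apply Rmult_integral in D as [D | D]; [lra |].
    assert (cos (u m) * cos (theta m) = 0) as W by nra.
    apply Rmult_integral in W as [W | W]; lra. }
  assert (Es : clairaut u theta m = 0) by (apply Hz; unfold m; lra).
  unfold clairaut in Es. apply Rmult_integral in Es as [Es | Es]; [lra |].
  pose proof (sin2_cos2 (theta m)). rewrite Es, Ec in *. unfold Rsqr in *. lra.
Qed.

Lemma graph_of_injective u v (I : R -> Prop) :
  (forall s t, I s -> I t -> v s = v t -> u s = u t) ->
  graph_on_v_axis (curve_image u v I).
Proof.
  intros Hinj.
  destruct (functional_choice (fun b a : R => (exists s, I s /\ v s = b) ->
     exists s, I s /\ v s = b /\ u s = a)) as [f Hf].
  { intros b. destruct (classic (exists s, I s /\ v s = b)) as [[s [Hs E]] | Hn].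
    - exists (u s). intros _. eauto.
    - exists 0. now intros Hb. }
  exists (fun b => exists s, I s /\ v s = b), f. intros a b. split.
  - intros [s [Hs E]]. injection E as -> ->. split; [eauto |].
    destruct (Hf (v s)) as [t [Ht [Ev Eu]]]; [eauto |].
    rewrite <- Eu. auto.
  - intros [Hb ->]. destruct (Hf b Hb) as [t [Ht [Ev Eu]]].
    exists t. split; [exact Ht |]. congruence.
Qed.

Lemma symmetric_bigraph_of_initial_conditions u v theta :
  soliton_profile u v theta -> u 0 = 0 -> theta 0 = 0 -> symmetric_bigraph u v.
Proof.
  intros H Hu Ht.
  pose proof (symmetric_of_initial_conditions u v theta H Hu Ht) as Hsym.
  assert (HL0 : clairaut u theta 0 = 0) by (unfold clairaut; rewrite Ht, sin_0; ring).
  assert (Hlt : forall s t, 0 < s -> s < t -> v s < v t).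
  { intros s t Hs Hst. apply (derive_pos_lt v (fun s => sin (theta s))); [exact Hst | |].
    - intros x _. apply (sp_v' _ _ _ H).
    - intros x Hx. apply (clairaut_sin_bound u v theta 0 x H); [lra |].
      apply (clairaut_pos_after_zero u v theta 0); [exact H | exact HL0 | lra]. }
  assert (Hinj : forall s t, 0 < s -> 0 < t -> v s = v t -> s = t).
  { intros s t Hs Ht' E. destruct (Rtotal_order s t) as [Hst | [Hst | Hst]]; [| exact Hst |].
    - specialize (Hlt s t Hs Hst). lra.
    - specialize (Hlt t s Ht' Hst). lra. }
  split; [| split].
  - assert (Hhalf : forall a b, curve_image u v (fun _ => True) (a, b) ->
      curve_image u v (fun _ => True) (- a, b)).
    { intros a b [s [_ E]]. injection E as -> ->. exists (- s).
      destruct (Hsym s) as [-> ->]. auto. }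
    intros a b. split; [apply Hhalf |].
    intros Hab. apply Hhalf in Hab. now rewrite Ropp_involutive in Hab.
  - apply graph_of_injective. intros s t Hs Ht' E. now rewrite (Hinj s t Hs Ht' E).
  - apply graph_of_injective. intros s t Hs Ht' E.
    destruct (Hsym s) as [_ Es]. destruct (Hsym t) as [_ Et].
    assert (- s = - t) by (apply Hinj; lra).
    now replace s with t by lra.
Qed.

(** The point of the equator on the same meridian is at distance [|u|]. *)
Lemma dist_to_equator_bound u v (s : R) :
  - (PI / 2) < u s < PI / 2 -> 0 <= dist_to_equator (alpha u v s) <= Rabs (u s).
Proof.
  intros Hu. unfold dist_to_equator.
  set (D := fun d => exists q, equator q /\ d = sphere_dist (alpha u v s) q).
  destruct (Glb_Rbar_correct D) as [Hlb Hglb].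
  assert (H0 : Rbar_le 0 (Glb_Rbar D)).
  { apply Hglb. intros d [[[x y] z] [_ ->]]. simpl. apply acos_bound. }
  assert (H1 : Rbar_le (Glb_Rbar D) (Rabs (u s))).
  { apply Hlb. exists (cos (v s), sin (v s), 0). split.
    - simpl. pose proof (sin2_cos2 (v s)). unfold Rsqr in *. split; [lra | reflexivity].
    - unfold alpha, sphere_dist.
      replace (cos (u s) * cos (v s) * cos (v s) + cos (u s) * sin (v s) * sin (v s) + sin (u s) * 0)
        with (cos (u s) * (sin (v s) * sin (v s) + cos (v s) * cos (v s))) by ring.
      pose proof (sin2_cos2 (v s)) as E. unfold Rsqr in E. rewrite E, Rmult_1_r.
      unfold Rabs. destruct (Rcase_abs (u s)).
      + rewrite <- cos_neg. symmetry. apply acos_cos. lra.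
      + symmetry. apply acos_cos. lra. }
  destruct (Glb_Rbar D); simpl in *; tauto.
Qed.

Lemma asymptotic_to_cylinder_of_latitude u v theta :
  soliton_profile u v theta -> is_lim u p_infty 0 -> is_lim u m_infty 0 ->
  asymptotic_to_cylinder u v.
Proof.
  intros H.
  assert (K : forall x : Rbar, is_lim u x 0 -> is_lim (fun s => dist_to_equator (alpha u v s)) x 0).
  { intros x Hx. apply (is_lim_le_le_loc (fun _ => 0) (fun s => Rabs (u s))).
    - assert (A : forall s, 0 <= dist_to_equator (alpha u v s) <= Rabs (u s)).
      { intros s. apply dist_to_equator_bound, (sp_latitude _ _ _ H). }
      apply filter_forall, A.
    - apply is_lim_const.
    - rewrite <- Rabs_R0. apply (is_lim_Rabs u x 0 Hx). }
  intros Hp Hm. split; now apply K.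
Qed.

(** * From the geometry to the equations *)

Lemma d_s_Psi u v theta (s t : R) :
  vertical_parametrization u v theta ->
  d_s (Psi u v) s t =
  (cos (u s) * (- sin (u s) * cos (v s) * cos (theta s) - sin (v s) * sin (theta s)),
   cos (u s) * (- sin (u s) * sin (v s) * cos (theta s) + cos (v s) * sin (theta s)),
   cos (u s) * (cos (u s) * cos (theta s)), 0).
Proof.
  intros H. pose proof (vp_u' _ _ _ H s) as Du. pose proof (vp_v' _ _ _ H s) as Dv.
  unfold d_s, deriv4, Psi. cbn [cx cy cz ct]. repeat apply f_equal2.
  - apply is_derive_unique. auto_derive; [repeat split; eexists; eassumption |].
    derive_value u s (vp_u' _ _ _ H). derive_value v s (vp_v' _ _ _ H). ring.
  - apply is_derive_unique. auto_derive; [repeat split; eexists; eassumption |].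
    derive_value u s (vp_u' _ _ _ H). derive_value v s (vp_v' _ _ _ H). ring.
  - apply is_derive_unique. auto_derive; [repeat split; eexists; eassumption |].
    derive_value u s (vp_u' _ _ _ H). ring.
  - apply Derive_const.
Qed.

Lemma d_t_Psi (u v : R -> R) (s t : R) : d_t (Psi u v) s t = (0, 0, 0, 1).
Proof.
  unfold d_t, deriv4, Psi. cbn [cx cy cz ct]. now rewrite !Derive_const, Derive_id.
Qed.

Lemma form_E_Psi u v theta (s t : R) :
  vertical_parametrization u v theta -> form_E (Psi u v) s t = cos (u s) ^ 2.
Proof.
  intros H. unfold form_E. rewrite (d_s_Psi u v theta) by exact H.
  unfold dot. cbn [cx cy cz ct].
  pose proof (sin2_cos2 (u s)) as E1. pose proof (sin2_cos2 (v s)) as E2.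
  pose proof (sin2_cos2 (theta s)) as E3. unfold Rsqr in *.
  assert (F1 : sin (u s) * sin (u s) = 1 - cos (u s) * cos (u s)) by lra.
  assert (F2 : sin (v s) * sin (v s) = 1 - cos (v s) * cos (v s)) by lra.
  assert (F3 : sin (theta s) * sin (theta s) = 1 - cos (theta s) * cos (theta s)) by lra.
  ring [F1 F2 F3].
Qed.

(** With E = (cos u)^2, F = f = g = 0 and G = 1, the mean curvature is e / E, and
    e = cos u (theta' - sin theta sin u) for the normal [n], whose product with
    the rotation field is cos u cos theta. *)
Lemma soliton_profile_of_R_soliton u v theta :
  vertical_parametrization u v theta -> R_soliton (Psi u v) ->
  soliton_profile u v theta.
Proof.
  intros H Hsol. split; [apply (vp_latitude _ _ _ H) | apply (vp_u' _ _ _ H)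
    | apply (vp_v' _ _ _ H) |].
  intros s.
  assert (Dth : forall x, is_derive theta x (Derive theta x)).
  { intros x. apply Derive_correct. exact (vp_smooth_theta _ _ _ H 1%nat x). }
  (* T = cos theta e_u + sin theta e_v is the unit tangent of the generating
     curve, and n = - sin theta e_u + cos theta e_v. *)
  pose (n := (sin (theta s) * sin (u s) * cos (v s) - cos (theta s) * sin (v s),
              sin (theta s) * sin (u s) * sin (v s) + cos (theta s) * cos (v s),
              - sin (theta s) * cos (u s), 0) : R4).
  assert (Hc : 0 < cos (u s)) by (destruct (vp_latitude _ _ _ H s); now apply cos_gt_0).
  assert (F1 : sin (u s) * sin (u s) = 1 - cos (u s) * cos (u s))
    by (pose proof (sin2_cos2 (u s)); unfold Rsqr in *; lra).
  assert (F2 : sin (v s) * sin (v s) = 1 - cos (v s) * cos (v s))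
    by (pose proof (sin2_cos2 (v s)); unfold Rsqr in *; lra).
  assert (F3 : sin (theta s) * sin (theta s) = 1 - cos (theta s) * cos (theta s))
    by (pose proof (sin2_cos2 (theta s)); unfold Rsqr in *; lra).
  assert (Hn : unit_normal (Psi u v) s 0 n).
  { unfold unit_normal. rewrite (d_s_Psi u v theta) by exact H. rewrite d_t_Psi.
    unfold dot, n, Psi. cbn [cx cy cz ct].
    repeat split; ring [F1 F2 F3]. }
  assert (He : form_e (Psi u v) s 0 n
    = cos (u s) * (Derive theta s - sin (theta s) * sin (u s))).
  { assert (Hss : d_s (d_s (Psi u v)) s 0 = deriv4 (fun s =>
      (cos (u s) * (- sin (u s) * cos (v s) * cos (theta s) - sin (v s) * sin (theta s)),
       cos (u s) * (- sin (u s) * sin (v s) * cos (theta s) + cos (v s) * sin (theta s)),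
       cos (u s) * (cos (u s) * cos (theta s)), 0)) s).
    { unfold d_s at 1, deriv4.
      apply f_equal2; [apply f_equal2; [apply f_equal2 |] |]; apply Derive_ext; intros r;
        now rewrite (d_s_Psi u v theta) by exact H. }
    unfold form_e. rewrite Hss. unfold deriv4. cbn [cx cy cz ct]. unfold dot, n.
    cbn [cx cy cz ct].
    pose proof (vp_u' _ _ _ H s) as Du. pose proof (vp_v' _ _ _ H s) as Dv.
    pose proof (Dth s) as Dt.
    pose (w := - sin (u s) * (cos (u s) * cos (theta s))).
    rewrite (is_derive_unique (fun s : R => cos (u s) *
        (- sin (u s) * cos (v s) * cos (theta s) - sin (v s) * sin (theta s))) s
      (w * (- sin (u s) * cos (v s) * cos (theta s) - sin (v s) * sin (theta s))
       + cos (u s) * (- cos (u s) * (cos (u s) * cos (theta s)) * cos (v s) * cos (theta s)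
           + sin (u s) * sin (v s) * sin (theta s) * cos (theta s)
           + sin (u s) * cos (v s) * sin (theta s) * Derive theta s
           - cos (v s) * sin (theta s) * sin (theta s)
           - sin (v s) * cos (theta s) * Derive theta s))).
    2:{ auto_derive; [repeat split; eexists; eassumption |].
        derive_value u s (vp_u' _ _ _ H). derive_value v s (vp_v' _ _ _ H).
        derive_value theta s Dth. unfold w. ring. }
    rewrite (is_derive_unique (fun s : R => cos (u s) *
        (- sin (u s) * sin (v s) * cos (theta s) + cos (v s) * sin (theta s))) s
      (w * (- sin (u s) * sin (v s) * cos (theta s) + cos (v s) * sin (theta s))
       + cos (u s) * (- cos (u s) * (cos (u s) * cos (theta s)) * sin (v s) * cos (theta s)
           - sin (u s) * cos (v s) * sin (theta s) * cos (theta s)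
           + sin (u s) * sin (v s) * sin (theta s) * Derive theta s
           - sin (v s) * sin (theta s) * sin (theta s)
           + cos (v s) * cos (theta s) * Derive theta s))).
    2:{ auto_derive; [repeat split; eexists; eassumption |].
        derive_value u s (vp_u' _ _ _ H). derive_value v s (vp_v' _ _ _ H).
        derive_value theta s Dth. unfold w. ring. }
    rewrite (is_derive_unique (fun s : R => cos (u s) * (cos (u s) * cos (theta s))) s
      (2 * w * cos (u s) * cos (theta s) - cos (u s) * cos (u s) * sin (theta s) * Derive theta s)).
    2:{ auto_derive; [repeat split; eexists; eassumption |].
        derive_value u s (vp_u' _ _ _ H). derive_value theta s Dth. unfold w. ring. }
    rewrite Derive_const. unfold w. ring [F1 F2 F3]. }
  assert (Hf : form_f (Psi u v) s 0 n = 0).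
  { unfold form_f, d_t, deriv4.
    assert (Hd : forall r, d_s (Psi u v) s r = d_s (Psi u v) s 0)
      by (intros r; now rewrite !(d_s_Psi u v theta) by exact H).
    rewrite !(Derive_ext _ _ _ (fun r => f_equal _ (Hd r))), !Derive_const.
    unfold dot. cbn [cx cy cz ct]. ring. }
  assert (Hg : form_g (Psi u v) s 0 n = 0).
  { unfold form_g, d_t at 1, deriv4.
    rewrite !(Derive_ext _ _ _ (fun r => f_equal _ (d_t_Psi u v s r))), !Derive_const.
    unfold dot. cbn [cx cy cz ct]. ring. }
  assert (HF : form_F (Psi u v) s 0 = 0).
  { unfold form_F. rewrite (d_s_Psi u v theta) by exact H. rewrite d_t_Psi.
    unfold dot. cbn [cx cy cz ct]. ring. }
  assert (HG : form_G (Psi u v) s 0 = 1).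
  { unfold form_G. rewrite d_t_Psi. unfold dot. cbn [cx cy cz ct]. ring. }
  destruct (Hsol s 0 n Hn) as [k1 [k2 [Hk HH]]].
  assert (Hrot : dot n (rotation (Psi u v s 0)) = cos (u s) * cos (theta s)).
  { unfold dot, n, rotation, Psi. cbn [cx cy cz ct]. ring [F1 F2 F3]. }
  rewrite Hrot in HH.
  (* The value at 0 gives k1 k2 = 0, and then the value at 1 gives
     e = E (k1 + k2). *)
  pose proof (Hk 0) as Hk0. pose proof (Hk 1) as Hk1.
  rewrite (form_E_Psi u v theta) in Hk0, Hk1 by exact H.
  rewrite He, Hf, Hg, HF, HG in Hk0, Hk1.
  assert (E : cos (u s) * (Derive theta s - sin (theta s) * sin (u s))
    = cos (u s) ^ 2 * (k1 + k2)) by lra.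
  rewrite <- HH in E.
  replace (sin (theta s) * sin (u s) + cos (u s) ^ 2 * cos (theta s)) with (Derive theta s).
  - apply Dth.
  - apply Rmult_eq_reg_l with (cos (u s)); [| lra]. lra.
Qed.

Lemma smooth_id : smooth (fun r => r).
Proof.
  assert (D : forall n y, Derive_n (fun r : R => r) (S n) y
    = match n with O => 1 | _ => 0 end).
  { intros n. induction n as [| n IH]; intros y.
    - apply Derive_id.
    - change (Derive (Derive_n (fun r : R => r) (S n)) y = 0).
      rewrite (Derive_ext _ _ _ IH). destruct n; apply Derive_const. }
  intros n x. destruct n as [| [| n]]; [exact I | apply ex_derive_id |].
  change (ex_derive (Derive_n (fun r : R => r) (S n)) x).
  apply (ex_derive_ext (fun _ => match n with O => 1 | _ => 0 end)).
  - intros y. symmetry. apply D.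
  - apply ex_derive_const.
Qed.

(** Each half of the generating curve, at constant height, is a divergent path;
    [e] is 1 or -1 according to the half. *)
Lemma infinite_length_of_complete u v theta (g : R -> R) (e : R) :
  vertical_parametrization u v theta -> complete_surface (Psi u v) ->
  smooth g -> e * e = 1 -> (forall r, g r = e * r) ->
  infinite_length (fun s => u (g s)).
Proof.
  intros H Hcomp Hg He Eg.
  apply is_lim_ext with (fun T => RInt (path_speed (Psi u v) g (fun _ => 0)) 0 T).
  - intros T. apply RInt_ext. intros r _. unfold path_speed.
    rewrite (form_E_Psi u v theta) by exact H.
    assert (D : Derive g r = e).
    { rewrite (Derive_ext _ _ _ Eg). apply is_derive_unique. auto_derive; [easy | ring]. }
    rewrite Derive_const, D.
    replace (cos (u (g r)) ^ 2 * e ^ 2 + 2 * form_F (Psi u v) (g r) 0 * (e * 0)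
      + form_G (Psi u v) (g r) 0 * 0 ^ 2) with (cos (u (g r)) ^ 2 * (e * e)) by ring.
    rewrite He, Rmult_1_r. apply sqrt_pow2.
    left. destruct (vp_latitude _ _ _ H (g r)). now apply cos_gt_0.
  - apply Hcomp; [exact Hg | intros n x; apply ex_derive_n_const |].
    intros M. exists (Rabs M + 1). intros r Hr. left. rewrite Eg, Rabs_mult.
    assert (Rabs e = 1) as ->.
    { assert (Hf : (e - 1) * (e + 1) = 0) by lra.
      apply Rmult_integral in Hf as [Hf | Hf].
      - replace e with 1 by lra. apply Rabs_R1.
      - replace e with (- (1)) by lra. rewrite Rabs_Ropp. apply Rabs_R1. }
    pose proof (Rle_abs M). pose proof (Rabs_pos M). rewrite (Rabs_right r) by lra. lra.
Qed.

(** * Tangency to the equator and the main alternative *)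

Lemma circle_angle (x y : R) : x ^ 2 + y ^ 2 = 1 -> exists a, x = cos a /\ y = sin a.
Proof.
  intros E. assert (Hx : -1 <= x <= 1) by nra.
  assert (Es : sin (acos x) = Rabs y).
  { rewrite sin_acos by exact Hx. rewrite <- sqrt_Rsqr_abs. f_equal. unfold Rsqr. lra. }
  destruct (Rle_dec 0 y) as [Hy | Hy].
  - exists (acos x). rewrite cos_acos, Es by exact Hx. split; [reflexivity |].
    rewrite Rabs_right; lra.
  - exists (- acos x). rewrite cos_neg, sin_neg, cos_acos, Es by exact Hx.
    split; [reflexivity |]. rewrite Rabs_left; lra.
Qed.

(** At such a point the curve is tangent to the equator, which solves the same
    equations. *)
Lemma cylinder_of_equilibrium u v theta (s0 : R) :
  soliton_profile u v theta -> u s0 = 0 -> cos (theta s0) = 0 ->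
  forall p, image (Psi u v) p <-> cylinder p.
Proof.
  intros H Hu Ht.
  assert (E : forall s, u s = 0 /\ v s = v s0 + sin (theta s0) * (s - s0)).
  { intros s.
    destruct (profile_unique _ _ _ _ _ _ s0 H
      (profile_equator (v s0) (theta s0) s0 Ht)) with (s := s) as [Eu [Ev _]]; auto.
    ring. }
  assert (Hs : sin (theta s0) * sin (theta s0) = 1).
  { pose proof (sin2_cos2 (theta s0)) as P. rewrite Ht in P. unfold Rsqr in P. lra. }
  intros [[[x y] z] t]. unfold image, cylinder, Psi. cbn [cx cy cz]. split.
  - intros [s [t' P]]. injection P as -> -> -> _.
    destruct (E s) as [-> _]. rewrite cos_0, sin_0.
    pose proof (sin2_cos2 (v s)). unfold Rsqr in *. split; [nra | reflexivity].
  - intros [P ->]. destruct (circle_angle x y P) as [a [-> ->]].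
    exists (s0 + sin (theta s0) * (a - v s0)), t.
    destruct (E (s0 + sin (theta s0) * (a - v s0))) as [-> ->].
    replace (v s0 + sin (theta s0) * (s0 + sin (theta s0) * (a - v s0) - s0))
      with (v s0 + sin (theta s0) * sin (theta s0) * (a - v s0)) by ring.
    rewrite Hs, cos_0, sin_0.
    replace (v s0 + 1 * (a - v s0)) with a by ring.
    now rewrite !Rmult_1_l.
Qed.

Lemma list_second_bounded (l : list (R * R)) :
  exists M, forall p, In p l -> snd p <= M.
Proof.
  induction l as [| q l [M HM]]; [now exists 0 |].
  exists (Rmax (snd q) M). intros p [<- | Hp]; [apply Rmax_l |].
  apply Rle_trans with M; [now apply HM | apply Rmax_r].
Qed.

Lemma is_lim_m_infty_of_reverse (f : R -> R) (l : Rbar) :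
  is_lim (fun s => f (0 - s)) p_infty l -> is_lim f m_infty l.
Proof.
  intros Hf. apply is_lim_ext with (fun s => f (0 - (-1 * s + 0))).
  - intros s. f_equal. ring.
  - apply (is_lim_comp_lin (fun s => f (0 - s)) (-1) 0 m_infty l); [| lra].
    replace (Rbar_plus (Rbar_mult (-1) m_infty) 0) with p_infty; [exact Hf |].
    simpl. destruct (Rle_dec 0 (-1)); [exfalso; lra |]. reflexivity.
Qed.

Theorem theorem4p2 (u v theta : R -> R)
  (Hvert : vertical_parametrization u v theta)
  (Hsol : R_soliton (Psi u v))
  (Hcomp : complete_surface (Psi u v)) :
  (forall p, image (Psi u v) p <-> cylinder p) \/
  ((self_intersecting u v /\
    asymptotic_to_v_axis u v /\
    (u 0 = 0 /\ v 0 = 0 /\ theta 0 = 0 -> symmetric_bigraph u v)) /\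
   (~ embedded (Psi u v) /\ meets_v_axis_infinitely_often u v) /\
   asymptotic_to_cylinder u v).
Proof.
  pose proof (soliton_profile_of_R_soliton u v theta Hvert Hsol) as H.
  destruct (classic (exists s, u s = 0 /\ cos (theta s) = 0)) as [[s0 [Hu Ht]] | Hne].
  { left. exact (cylinder_of_equilibrium u v theta s0 H Hu Ht). }
  right.
  pose proof (profile_reverse u v theta 0 PI H sin_PI cos_PI) as Hr.
  assert (Hlen : infinite_length u).
  { apply (infinite_length_of_complete u v theta (fun r => r) 1 Hvert Hcomp smooth_id);
      intros; ring. }
  assert (Hlenr : infinite_length (fun s => u (0 - s))).
  { apply is_lim_ext with (fun T => RInt (fun r => cos (u (- r))) 0 T).
    - intros T. apply RInt_ext. intros r _. now rewrite Rminus_0_l.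
    - apply (infinite_length_of_complete u v theta (fun r => - r) (-1) Hvert Hcomp).
      + intros n x. apply ex_derive_n_opp, smooth_id.
      + ring.
      + intros; ring. }
  assert (HL : clairaut u theta 0 ^ 2 < 1).
  { apply (clairaut_sq_lt_1 u v theta 0 H). intros Hn. apply Hne. now exists 0. }
  assert (HL1 : -1 < clairaut u theta 0) by nra.
  assert (HLr : -1 < clairaut (fun s => u (0 - s)) (fun s => theta (0 - s) + PI) 0).
  { unfold clairaut in *. rewrite neg_sin, Rminus_0_r. nra. }
  destruct (graph_end_exists u v theta 0 H Hlen HL1) as [S1 [psi1 [HS1 G1]]].
  destruct (graph_end_exists _ _ _ 0 Hr Hlenr HLr) as [S2 [psi2 [HS2 G2]]].
  destruct (graph_ends_cross _ _ _ _ _ _ _ _ _ _ 0 G1 G2) as [x [_ [Hx1 [Hx2 E]]]].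
  assert (Hup : is_lim u p_infty 0) by exact (latitude_tends_to_0 _ _ _ H Hlen HL1).
  assert (Hum : is_lim u m_infty 0).
  { apply is_lim_m_infty_of_reverse. exact (latitude_tends_to_0 _ _ _ Hr Hlenr HLr). }
  split; [split; [| split] | split; [split |]].
  - exists (psi1 x), (0 - psi2 x). split; [| split].
    + pose proof (ge_above _ _ _ _ _ G1 x Hx1). pose proof (ge_above _ _ _ _ _ G2 x Hx2). lra.
    + exact E.
    + pose proof (ge_right_inverse _ _ _ _ _ G1 x Hx1).
      pose proof (ge_right_inverse _ _ _ _ _ G2 x Hx2) as Ev2. simpl in Ev2. congruence.
  - repeat split; [exact Hup | | exact Hum |].
    + exact (longitude_tends_to_infinity _ _ _ H Hlen HL1).
    + apply is_lim_m_infty_of_reverse. exact (longitude_tends_to_infinity _ _ _ Hr Hlenr HLr).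
  - intros [Hu0 [_ Ht0]]. exact (symmetric_bigraph_of_initial_conditions u v theta H Hu0 Ht0).
  - exact (not_embedded_of_crossing _ _ _ _ _ _ _ x G1 G2 Hx1 Hx2 E).
  - intros l. destruct (list_second_bounded l) as [M HM].
    destruct (graph_ends_cross _ _ _ _ _ _ _ _ _ _ M G1 equator_graph_end)
      as [y [Hy [Hy1 [_ Ey]]]].
    exists (psi1 y). split; [exact Ey |]. intros Hin. apply HM in Hin.
    simpl in Hin. rewrite (ge_right_inverse _ _ _ _ _ G1 y Hy1) in Hin. lra.
  - exact (asymptotic_to_cylinder_of_latitude u v theta H Hup Hum).
Qed.
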